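(* Let $\mathcal{A}$ be a semi-simple rigid $K$-category and let $M\in\mathcal{A}$ be of integral type. Write $A=\operatorname{End}(M)=\prod_iA_i$ with simple factors $A_i$ and corresponding central idempotents $e_i$. Then: a) For any $f\in\operatorname{End}(M)$, $Z(f,t)\in K(t)$. More precisely, $$Z(f,t)=\prod_i\operatorname{Nrd}_{A_i}(e_i-e_ift)^{-\mu_i(M)}$$ where, for all $i$, $\operatorname{Nrd}_{A_i}(e_i-e_ift):=N_{Z_i(M)/K}\operatorname{Nrd}_{A_i/Z_i(M)}(e_i-e_ift)$ denotes the inverse reduced characteristic polynomial of the element $e_if$ of $A_i$. b) If $f$ is invertible, one has the functional equation $$Z(f^{-1},t^{-1})=(-t)^{\chi(M)}\det(f)Z(f,t)$$ where $\chi(M)=\operatorname{tr}(1_M)$ and $\det(f)=\prod_i\operatorname{Nrd}_{A_i}(e_if)^{\mu_i(M)}$.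
   Context: $K$ is a field of characteristic $0$. A rigid $K$-category is an additive $K$-linear symmetric monoidal category with $K$-bilinear tensor product, in which every object has a dual, and such that $\operatorname{End}(\mathbf{1})=K$; it is not assumed abelian or pseudo-abelian. $\operatorname{tr}(f)\in K$ denotes the categorical trace of an endomorphism $f$. The category is semi-simple if all rings $\operatorname{End}(M)$ are semi-simple; they are then finite-dimensional semi-simple $K$-algebras. For a finite-dimensional simple $K$-algebra $A$ with centre $Z(A)$, $\operatorname{Trd}_A=\operatorname{Tr}_{Z(A)/K}\circ\operatorname{Trd}_{A/Z(A)}$ and $\operatorname{Nrd}_A=N_{Z(A)/K}\circ\operatorname{Nrd}_{A/Z(A)}$; for $A=\prod A_i$ semi-simple, $\operatorname{Trd}_A=\sum_i\operatorname{Trd}_{A_i}$. $Z_i(M)$ is the centre of the $i$-th simple factor $A_i$ of $\operatorname{End}(M)$. There is a unique $\mu(M)\in\operatorname{End}(M)$ with $\operatorname{tr}(f)=\operatorname{Trd}_{\operatorname{End}(M)}(\mu(M)f)$ for all $f$; it is central and invertible, and $\mu(M)=\sum_i\mu_i(M)e_i$ with $\mu_i(M)\in Z_i(M)$. $M$ is of integral type if all $\mu_i(M)$ belong to $\mathbf{Z}$. The zeta function of $f\in\operatorname{End}(M)$ is $Z(f,t)=\exp\left(\sum_{n\ge1}\operatorname{tr}(f^n)\frac{t^n}{n}\right)\in K[[t]]$. In b), $Z(f^{-1},t^{-1})$ is the rational function $Z(f^{-1},t)$ evaluated at $t^{-1}$. *)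

(* Defs.v *)
From HB Require Import structures.
From mathcomp Require Import all_boot all_order all_algebra all_field.
From mathcomp Require Import boolp classical_sets.

Set Implicit Arguments.
Unset Strict Implicit.
Unset Printing Implicit Defensive.

Set Warnings "-redundant-canonical-projection".

Import GRing.Theory.

Local Open Scope ring_scope.

Record linCat (K : fieldType) := LinCat {
  ob :> Type;
  hom : ob -> ob -> lmodType K;
  idc : forall X, hom X X;
  (* [comp g f] is "g after f" *)
  comp : forall X Y Z, hom Y Z -> hom X Y -> hom X Z;
  compA : forall X Y Z T (h : hom Z T) (g : hom Y Z) (f : hom X Y),
    comp h (comp g f) = comp (comp h g) f;
  comp1c : forall X Y (f : hom X Y), comp (idc Y) f = f;
  compc1 : forall X Y (f : hom X Y), comp f (idc X) = f;
  comp_linl : forall X Y Z (f : hom X Y) (a : K) (g g' : hom Y Z),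
    comp (a *: g + g') f = a *: comp g f + comp g' f;
  comp_linr : forall X Y Z (g : hom Y Z) (a : K) (f f' : hom X Y),
    comp g (a *: f + f') = a *: comp g f + comp g f'
}.

Arguments idc {K C} X : rename.
Arguments comp {K C X Y Z} g f : rename.

Notation "g \oc f" := (comp g f) (at level 40, left associativity).

Definition additive_cat (K : fieldType) (C : linCat K) : Prop :=
  (exists Z : C, idc Z = 0)
  /\ (forall X Y : C, exists (P : C) (iX : hom X P) (iY : hom Y P)
        (pX : hom P X) (pY : hom P Y),
      [/\ pX \oc iX = idc X, pY \oc iY = idc Y, pY \oc iX = 0, pX \oc iY = 0
        & iX \oc pX + iY \oc pY = idc P]).

Record symMonoidal (K : fieldType) (C : linCat K) := SymMonoidal {
  unit_ob : C;
  tens : C -> C -> C;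
  tensf : forall X X' Y Y' : C,
    hom X X' -> hom Y Y' -> hom (tens X Y) (tens X' Y');
  tensf1 : forall X Y : C, tensf (idc X) (idc Y) = idc (tens X Y);
  tensf_comp : forall (X X' X'' Y Y' Y'' : C) (f' : hom X' X'') (f : hom X X')
      (g' : hom Y' Y'') (g : hom Y Y'),
    tensf (f' \oc f) (g' \oc g) = tensf f' g' \oc tensf f g;
  tensf_linl : forall (X X' Y Y' : C) (g : hom Y Y') (a : K) (f f' : hom X X'),
    tensf (a *: f + f') g = a *: tensf f g + tensf f' g;
  tensf_linr : forall (X X' Y Y' : C) (f : hom X X') (a : K) (g g' : hom Y Y'),
    tensf f (a *: g + g') = a *: tensf f g + tensf f g';
  assoc : forall X Y Z : C, hom (tens (tens X Y) Z) (tens X (tens Y Z));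
  associ : forall X Y Z : C, hom (tens X (tens Y Z)) (tens (tens X Y) Z);
  assocK : forall X Y Z, associ X Y Z \oc assoc X Y Z = idc _;
  associK : forall X Y Z, assoc X Y Z \oc associ X Y Z = idc _;
  lunit : forall X : C, hom (tens unit_ob X) X;
  luniti : forall X : C, hom X (tens unit_ob X);
  lunitK : forall X, luniti X \oc lunit X = idc _;
  lunitiK : forall X, lunit X \oc luniti X = idc _;
  runit : forall X : C, hom (tens X unit_ob) X;
  runiti : forall X : C, hom X (tens X unit_ob);
  runitK : forall X, runiti X \oc runit X = idc _;
  runitiK : forall X, runit X \oc runiti X = idc _;
  braid : forall X Y : C, hom (tens X Y) (tens Y X);
  braidK : forall X Y, braid Y X \oc braid X Y = idc _;
  assoc_nat : forall (X X' Y Y' Z Z' : C)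
      (f : hom X X') (g : hom Y Y') (h : hom Z Z'),
    assoc X' Y' Z' \oc tensf (tensf f g) h
    = tensf f (tensf g h) \oc assoc X Y Z;
  lunit_nat : forall (X X' : C) (f : hom X X'),
    lunit X' \oc tensf (idc unit_ob) f = f \oc lunit X;
  runit_nat : forall (X X' : C) (f : hom X X'),
    runit X' \oc tensf f (idc unit_ob) = f \oc runit X;
  braid_nat : forall (X X' Y Y' : C) (f : hom X X') (g : hom Y Y'),
    braid X' Y' \oc tensf f g = tensf g f \oc braid X Y;
  pentagon : forall W X Y Z : C,
    tensf (idc W) (assoc X Y Z) \oc assoc W (tens X Y) Z
      \oc tensf (assoc W X Y) (idc Z)
    = assoc W X (tens Y Z) \oc assoc (tens W X) Y Z;
  triangle : forall X Y : C,
    tensf (idc X) (lunit Y) \oc assoc X unit_ob Y = tensf (runit X) (idc Y);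
  hexagon : forall X Y Z : C,
    assoc Y Z X \oc braid X (tens Y Z) \oc assoc X Y Z
    = tensf (idc Y) (braid X Z) \oc assoc Y X Z \oc tensf (braid X Y) (idc Z)
}.

Record rigidCat (K : fieldType) := RigidCat {
  ucat :> linCat K;
  ucat_additive : additive_cat ucat;
  mon : symMonoidal ucat;
  dual : ucat -> ucat;
  coev : forall X : ucat, hom (unit_ob mon) (tens mon X (dual X));
  ev : forall X : ucat, hom (tens mon (dual X) X) (unit_ob mon);
  dual_zigzag : forall X : ucat,
    runit mon X \oc tensf mon (idc X) (ev X) \oc assoc mon X (dual X) X
      \oc tensf mon (coev X) (idc X) \oc luniti mon X = idc X;
  dual_zagzig : forall X : ucat,
    lunit mon (dual X) \oc tensf mon (ev X) (idc (dual X))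
      \oc associ mon (dual X) X (dual X)
      \oc tensf mon (idc (dual X)) (coev X) \oc runiti mon (dual X)
    = idc (dual X);
  (* End(1) = K *)
  end1 : hom (unit_ob mon) (unit_ob mon) -> K;
  end1K : forall h, end1 h *: idc (unit_ob mon) = h;
  end1_scale : forall a, end1 (a *: idc (unit_ob mon)) = a
}.

(* Only a [pzRingType] and an [lmodType]: End(M) is the zero ring when M = 0,   *)
(* so it cannot be an [algType].                                               *)
Definition Endo (K : fieldType) (C : linCat K) (M : C) : Type := hom M M.

Section EndoRing.
Variables (K : fieldType) (C : linCat K) (M : C).

HB.instance Definition _ := GRing.Lmodule.copy (Endo M) (hom M M).

Let mulE (g f : Endo M) : Endo M := g \oc f.

Fact mulEA : associative mulE.
Proof. by move=> h g f; exact: compA. Qed.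
Fact mul1E : left_id (idc M : Endo M) mulE.
Proof. by move=> f; exact: comp1c. Qed.
Fact mulE1 : right_id (idc M : Endo M) mulE.
Proof. by move=> f; exact: compc1. Qed.
Fact mulEDl : left_distributive mulE +%R.
Proof. by move=> g g' f; have := comp_linl f 1 g g'; rewrite !scale1r. Qed.
Fact mulEDr : right_distributive mulE +%R.
Proof. by move=> g f f'; have := comp_linr g 1 f f'; rewrite !scale1r. Qed.

HB.instance Definition _ :=
  GRing.Zmodule_isPzRing.Build (Endo M) mulEA mul1E mulE1 mulEDl mulEDr.

End EndoRing.

Definition ctr (K : fieldType) (C : rigidCat K) (M : C) (f : Endo M) : K :=
  end1 (ev M \oc braid (mon C) M (dual M)
        \oc tensf (mon C) (f : hom M M) (idc (dual M)) \oc coev M).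

Definition left_ideal (R : pzRingType) (I : set R) : Prop :=
  [/\ I 0, (forall x y, I x -> I y -> I (x + y)) & (forall a x, I x -> I (a * x))].

(* R is semi-simple as a left module over itself. *)
Definition semisimple_ring (R : pzRingType) : Prop :=
  forall I : set R, left_ideal I ->
    exists J : set R, [/\ left_ideal J,
      (forall x, exists2 y, I y & exists2 z, J z & x = y + z)
      & (forall x, I x -> J x -> x = 0)].

Definition semisimple_cat (K : fieldType) (C : rigidCat K) : Prop :=
  forall M : C, semisimple_ring (Endo M).

Section Reduced.
Variables (K : fieldType) (A : falgType K).

Definition simple_alg : Prop :=
  forall U : {vspace A}, (fullv * U <= U)%VS -> (U * fullv <= U)%VS ->
    U = 0%VS \/ U = fullv.

Definition centre : {vspace A} := 'Z(fullv)%VS.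

(* A splitting of A over its centre Z: a field L, made into an extension of Z  *)
(* by [sp_centre], and a Z-linear ring morphism A -> M_n(L) inducing an        *)
(* isomorphism between the L-algebras A (x)_Z L and M_n(L): it is onto by      *)
(* [sp_span] and the dimensions agree by [sp_dim].                             *)
Record splitting := Splitting {
  sp_field : fieldType;
  sp_deg : nat;
  sp_map :> {rmorphism A -> 'M[sp_field]_sp_deg};
  sp_centre : forall z, z \in centre -> is_scalar_mx (sp_map z);
  sp_dim : \dim (fullv : {vspace A}) = (sp_deg ^ 2 * \dim centre)%N;
  sp_span : forall B : 'M[sp_field]_sp_deg, exists c : A -> sp_field,
    B = \sum_(x <- vbasis (fullv : {vspace A})) c x *: sp_map x
}.

(* Image of P under A[t] -> M_n(L)[t] = M_n(L[t]). *)
Definition sp_poly (S : splitting) (P : {poly A}) :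
    'M[{poly sp_field S}]_(sp_deg S) :=
  \matrix_(i, j) \poly_(k < size P) S P`_k i j.

(* Trd_{A/Z(A)}, Nrd_{A/Z(A)} and Nrd_{A[t]/Z(A)[t]}, with values in Z(A),     *)
(* resp. Z(A)[t], seen inside A, resp. A[t].                                   *)
Definition trdZ (a : A) : A :=
  xget 0 [set z | z \in centre
                  /\ exists S : splitting, S z = (\tr (S a))%:M].

Definition nrdZ (a : A) : A :=
  xget 0 [set z | z \in centre
                  /\ exists S : splitting, S z = (\det (S a))%:M].

Definition nrdZ_poly (P : {poly A}) : {poly A} :=
  xget 0 [set p : {poly A} | (forall k, p`_k \in centre)
                  /\ exists S : splitting,
                       forall k, S p`_k = ((\det (sp_poly S P))`_k)%:M].

(* Matrix of the multiplication by z on the K-vector space Z(A). *)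
Definition centre_mx (z : A) : 'M[K]_(\dim centre) :=
  \matrix_(i, j) coord (vbasis centre) j (z * (vbasis centre)`_i).

(* Same for p in Z(A)[t], acting on the free K[t]-module Z(A)[t]. *)
Definition centre_mx_poly (p : {poly A}) : 'M[{poly K}]_(\dim centre) :=
  \matrix_(i, j) \poly_(k < size p) centre_mx p`_k i j.

Definition Trd (a : A) : K := \tr (centre_mx (trdZ a)).
Definition Nrd (a : A) : K := \det (centre_mx (nrdZ a)).
Definition Nrd_poly (P : {poly A}) : {poly K} :=
  \det (centre_mx_poly (nrdZ_poly P)).

End Reduced.

(* A = End(M) = \prod_i A_i, given by its projections. The i-th projection     *)
(* identifies e_i A with A_i, the idempotent e_i with 1 and e_i f with         *)
(* [factor_pr D i f], so e_i - e_i f t with [1 - (factor_pr D i f)%:P * 'X].   *)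
Record simple_factors (K : fieldType) (C : linCat K) (M : C) := SimpleFactors {
  factor_idx : finType;
  factor : factor_idx -> falgType K;
  factor_simple : forall i, simple_alg (factor i);
  factor_pr : forall i, {rmorphism Endo M -> factor i};
  factor_scale : forall i (a : K) (f : Endo M),
    factor_pr i (a *: f) = a *: factor_pr i f;
  factor_prod : forall y : (forall i, factor i),
    exists! f : Endo M, forall i, factor_pr i f = y i
}.

Arguments factor {K C M} D i : rename.
Arguments factor_pr {K C M} D i : rename.

Section Multiplicities.
Variables (K : fieldType) (C : rigidCat K) (M : C) (D : simple_factors M).

Definition TrdEnd (f : Endo M) : K := \sum_i Trd (factor_pr D i f).

Definition mu : Endo M :=
  xget 0 [set u | forall f : Endo M, ctr f = TrdEnd (u * f)].

Definition mu_ (i : factor_idx D) : factor D i := factor_pr D i mu.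

Definition det_end (m : factor_idx D -> int) (f : Endo M) : K :=
  \prod_i Nrd (factor_pr D i f) ^ m i.

End Multiplicities.

(* The simple factors are unique up to permutation and isomorphism, so that    *)
(* this does not depend on D.                                                  *)
Definition integral_type (K : fieldType) (C : rigidCat K) (M : C) : Prop :=
  forall (D : simple_factors M) (i : factor_idx D),
    exists m : int, mu_ i = m%:~R.

(* An element of K[[t]] is represented by the sequence of its coefficients.    *)

(* exp(u) for u(0) = 0: then u^k / k! does not contribute to the coefficient   *)
(* of t^n when k > n.                                                          *)
Definition fps_exp (K : fieldType) (u : nat -> K) : nat -> K := fun n =>
  (\sum_(k < n.+1) (k`!%:R)^-1 *: (\poly_(i < n.+1) u i) ^+ k)`_n.

Definition zeta (K : fieldType) (C : rigidCat K) (M : C) (f : Endo M) :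
    nat -> K :=
  fps_exp (fun n => if n == 0%N then 0 else ctr (f ^+ n) / n%:R).

Notation "{ 'ratfun' K }" := {fraction {poly K}}
  (at level 0, format "{ 'ratfun'  K }").
Notation "p %:RF" := (@FracField.tofrac _ p)
  (at level 2, left associativity, format "p %:RF").

(* The equality z = r in K((t)): r = p / q with q z = p in K[[t]]. *)
Definition fps_eq_ratfun (K : fieldType) (z : nat -> K) (r : {ratfun K}) : Prop :=
  exists p q : {poly K}, [/\ q != 0, r = p%:RF / q%:RF
    & forall n, \sum_(i < n.+1) q`_i * z (n - i)%N = p`_n].

Definition ratfun_t (K : fieldType) : {ratfun K} := 'X%:RF.

Definition ratfun_const (K : fieldType) (a : K) : {ratfun K} := (a%:P)%:RF.

Definition poly_tinv (K : fieldType) (p : {poly K}) : {ratfun K} :=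
  (map_poly (@ratfun_const K) p).[(ratfun_t K)^-1].

(* r(t^-1), computed on the fraction representing r. *)
Definition ratfun_tinv (K : fieldType) (r : {ratfun K}) : {ratfun K} :=
  poly_tinv (\n_(generic_quotient.repr r)) / poly_tinv (\d_(generic_quotient.repr r)).

(* Main.v *)
Require Import Defs.
From HB Require Import structures.
From mathcomp Require Import all_boot all_order all_algebra all_field.
From mathcomp Require Import perm generic_quotient.
From mathcomp Require Import boolp classical_sets.

(** Let A_i be the simple factors of End(M), f_i the component of f in A_i and
    m_i the integers such that tr(f) = sum_i m_i Trd(f_i).

    Part a) compares two power series with constant term 1 through their
    logarithmic derivatives.  The exponential in Z(f,t) satisfies t z' = s z
    with s = sum_(n >= 1) tr(f^n) t^n ([fps_exp_logder]).  By Jacobi's formula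
    for the derivative of a determinant ([deriv_det], [det_logder]),
    Nrd(1 - a t) satisfies t z' = - (sum_(n >= 1) Trd(a^n) t^n) z
    ([Nrd_poly_logder]); hence prod_i Nrd(1 - f_i t)^(-m_i) satisfies the
    equation of Z(f,t), and in characteristic 0 that equation has a single
    solution with constant term 1 ([logder_unique]).

    Part b) comes from the identity 1 - t B = (- B) (t - B^-1) of matrices: up
    to the factor (-1)^n det(B), passing from B to B^-1 reverses the order of
    the coefficients of det(1 - t B) ([det_charseries_inverse]).  Taking norms
    from the centre gives the functional equation of each factor
    ([Nrd_poly_inverse]), with an exponent equal to Trd(1); these exponents
    add up to chi(M) = tr(1) with the multiplicities m_i.

    Four facts on algebras make these formulas meaningful.
    - A simple algebra A with centre Z has a splitting ([simple_splitting]): a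
      maximal commutative subfield L of e A e acts on the right of a minimal
      left ideal A e, and by Jacobson's density argument A spans all L-linear
      endomorphisms of A e.
    - Reduced traces and reduced characteristic polynomials have central values
      that do not depend on the splitting S.  For the trace, n tr(S a) is the
      trace over Z of the left multiplication by a ([trace_over_centre]), and n
      can be divided out; for the characteristic polynomial, the equation
      t z' = s z computes the coefficients from the traces of the powers of a
      ([sp_redchar]).
    - The form (a, b) |-> Trd(a b) is nondegenerate on a simple algebra, since
      its radical is a two-sided ideal and Trd(1) is a nonzero integer; this
      yields mu(M) ([mu_exists]).
    - End(M) has finite dimension ([endo_fin_gen]), because in the semi-simple
      ring End(1 + X) the ideal generated by the projector onto 1 is generated
      by an idempotent; so it is a product of simple algebras
      ([simple_factors_exist]), which gives the rationality of Z(f,t). *)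

Set Implicit Arguments.
Unset Strict Implicit.
Unset Printing Implicit Defensive.

Import GRing.Theory.

Local Open Scope ring_scope.

(** * Power series through their logarithmic derivatives *)

(** The equation t z' = s z between power series, coefficient by coefficient; the
    constant coefficient of s is never read.  The ring may be noncommutative, so
    that s and z can be series of matrices. *)
Definition logder (R : pzRingType) (s z : nat -> R) :=
  forall n, z n *+ n = \sum_(i < n) s i.+1 * z (n - i.+1)%N.

Lemma eq_logder (R : pzRingType) (s s' z z' : nat -> R) :
  (forall n, s n.+1 = s' n.+1) -> z =1 z' -> logder s z -> logder s' z'.
Proof.
move=> es ez h n; rewrite -ez h; apply: eq_bigr => i _.
by rewrite es ez.
Qed.

(** The coefficient of index n of z is determined by the previous ones as soon as
    the multiplication by n is injective. *)
Lemma logder_unique (R : pzRingType) (s z w : nat -> R) :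
  (forall n (x : R), x *+ n.+1 = 0 -> x = 0) ->
  logder s z -> logder s w -> z 0%N = w 0%N -> z =1 w.
Proof.
move=> inj hz hw h0 n.
have [m] := ubnP n; elim: m n => // m IHm [|n] //; rewrite ltnS => le_nm.
apply/eqP; rewrite -subr_eq0; apply/eqP; apply: (inj n).
rewrite mulrnBl hz hw -sumrB big1 // => i _.
rewrite IHm ?subrr //.
by apply: leq_ltn_trans le_nm; rewrite subSS leq_subr.
Qed.

Lemma logder_morph (R S : pzRingType) (phi : R -> S) (s z : nat -> R) :
  {morph phi : x y / x + y} -> {morph phi : x y / x * y} -> 
  logder s z -> logder (phi \o s) (phi \o z).
Proof.
move=> phiD phiM h n.
have phi0 : phi 0 = 0 by apply: (addrI (phi 0)); rewrite -phiD !addr0.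
have phiMn x k : phi (x *+ k) = phi x *+ k.
  by elim: k => [|k IH]; rewrite ?mulr0n // !mulrS phiD IH.
rewrite /= -phiMn h (big_morph phi phiD phi0).
by apply: eq_bigr => i _; rewrite phiM.
Qed.

Section LowCoefficients.
Variable R : comNzRingType.
Implicit Types p q : {poly R}.

(** Congruence modulo t^(N+1): power series are handled through their truncations,
    which are polynomials. *)
Definition low_eq N p q := forall k, (k <= N)%N -> p`_k = q`_k.

Lemma low_eqD N p q p' q' :
  low_eq N p q -> low_eq N p' q' -> low_eq N (p + p') (q + q').
Proof. by move=> h h' k lek; rewrite !coefD h ?h'. Qed.

Lemma low_eqM N p q p' q' :
  low_eq N p q -> low_eq N p' q' -> low_eq N (p * p') (q * q').
Proof.
move=> h h' k lek; rewrite !coefM; apply: eq_bigr => i _.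
rewrite h ?h' //; first by apply: leq_trans lek; rewrite leq_subr.
by apply: leq_trans lek; rewrite -ltnS.
Qed.

Lemma low_eq_trans N p q r : low_eq N p q -> low_eq N q r -> low_eq N p r.
Proof. by move=> h h' k lek; rewrite h ?h'. Qed.

Lemma low_eq_sym N p q : low_eq N p q -> low_eq N q p.
Proof. by move=> h k lek; rewrite h. Qed.

Lemma low_eq_sum N (I : finType) (F G : I -> {poly R}) :
  (forall i, low_eq N (F i) (G i)) -> low_eq N (\sum_i F i) (\sum_i G i).
Proof.
by move=> h k lek; rewrite !coef_sum; apply: eq_bigr => i _; rewrite h.
Qed.

Definition trunc N (u : nat -> R) : {poly R} := \poly_(i < N.+1) u i.

Lemma trunc_coef N u k : (k <= N)%N -> (trunc N u)`_k = u k.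
Proof. by move=> lekN; rewrite coef_poly ltnS lekN. Qed.

Definition no_const (u : nat -> R) n := if n == 0%N then 0 else u n.

Lemma coefXderiv p n : ('X * p^`())`_n = p`_n *+ n.
Proof. by rewrite coefXM; case: n => [|n] //=; rewrite coef_deriv. Qed.

Lemma coef_no_constM N (s z : nat -> R) p n : (n <= N)%N ->
  (forall k, (k <= n)%N -> p`_k = z k) ->
  (trunc N (no_const s) * p)`_n = \sum_(i < n) s i.+1 * z (n - i.+1)%N.
Proof.
move=> leN hp; rewrite coefM big_ord_recl trunc_coef //= mul0r add0r.
apply: eq_bigr => i _; rewrite /bump add1n trunc_coef; last exact: leq_trans leN.
by rewrite hp // leq_subr.
Qed.

Lemma logderP (s z : nat -> R) :
  logder s z <->
  forall N, low_eq N ('X * (trunc N z)^`()) (trunc N (no_const s) * trunc N z).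
Proof.
split=> [h N n leN | h n].
  rewrite coefXderiv trunc_coef // h; symmetry; apply: coef_no_constM => // k lek.
  by rewrite trunc_coef // (leq_trans lek).
have /(_ n (leqnn n)) := h n.
rewrite coefXderiv trunc_coef // => ->; apply: coef_no_constM => // k lek.
by rewrite trunc_coef.
Qed.

Definition conv (u v : nat -> R) n := \sum_(i < n.+1) u i * v (n - i)%N.

Lemma trunc_conv N u v : low_eq N (trunc N (conv u v)) (trunc N u * trunc N v).
Proof.
move=> k lek; rewrite trunc_coef // coefM; apply: eq_bigr => i _.
rewrite !trunc_coef //; first by apply: leq_trans lek; rewrite leq_subr.
by apply: leq_trans lek; rewrite -ltnS.
Qed.

Lemma low_eq_Xderiv N p q : low_eq N p q -> low_eq N ('X * p^`()) ('X * q^`()).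
Proof. by move=> h k lek; rewrite !coefXderiv h. Qed.

Lemma low_eq_refl N p : low_eq N p p. Proof. by []. Qed.

(** Leibniz rule: logarithmic derivatives add up in a product. *)
Lemma logder_conv (s s' z z' : nat -> R) :
  logder s z -> logder s' z' ->
  logder (fun n => s n + s' n) (conv z z').
Proof.
move=> /logderP hz /logderP hz'; apply/logderP => N.
have h := low_eq_Xderiv (@trunc_conv N z z').
apply: low_eq_trans h _.
rewrite derivM mulrDr; set a := (trunc N z)^`(); set b := (trunc N z')^`().
have -> : 'X * (a * trunc N z') + 'X * (trunc N z * b) =
    'X * a * trunc N z' + trunc N z * ('X * b).
  by rewrite mulrA [in X in _ + X]mulrCA.
have -> : trunc N (no_const (fun n => s n + s' n)) =
          trunc N (no_const s) + trunc N (no_const s').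
  apply/polyP=> k; rewrite coefD !coef_poly /no_const.
  by case: (k < N.+1)%N; rewrite ?addr0 //; case: (k == 0)%N; rewrite ?addr0.
apply: low_eq_trans (low_eqM (@low_eq_refl N _) (low_eq_sym (@trunc_conv N z z'))).
rewrite mulrDl [trunc N (no_const s) * _]mulrA.
rewrite [trunc N (no_const s') * _]mulrCA.
apply: low_eqD; apply: low_eqM => //; exact: low_eq_refl.
Qed.

Lemma conv0 (z z' : nat -> R) : conv z z' 0%N = z 0%N * z' 0%N.
Proof. by rewrite /conv big_ord1 subnn. Qed.

Lemma logder_polyM (s s' : nat -> R) p p' :
  logder s (nth 0 p) -> logder s' (nth 0 p') ->
  logder (fun n => s n + s' n) (nth 0 (p * p')).
Proof.
move=> h h'; apply: eq_logder (logder_conv h h') => // n.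
by rewrite coefM.
Qed.

Lemma logder_poly1 : logder (fun=> 0) (nth 0 (1 : {poly R})).
Proof.
by case=> [|n]; rewrite big1 ?mulr0n ?coef1 ?mul0rn // => i _; rewrite mul0r.
Qed.

Lemma logder_polyX (s : nat -> R) p k :
  logder s (nth 0 p) -> logder (fun n => s n *+ k) (nth 0 (p ^+ k)).
Proof.
move=> h; elim: k => [|k IHk].
  apply: eq_logder logder_poly1 => // n; by rewrite mulr0n.
apply: eq_logder (logder_polyM h IHk) => n; first by rewrite mulrS.
by rewrite exprS.
Qed.

Lemma logder_poly_prod (I : finType) (s : I -> nat -> R) (p : I -> {poly R}) :
  (forall i, logder (s i) (nth 0 (p i))) ->
  logder (fun n => \sum_i s i n) (nth 0 (\prod_i p i)).
Proof.
move=> h.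
elim: (index_enum I) => [|i r IHr].
  by rewrite big_nil; apply: eq_logder logder_poly1 => // n; rewrite big_nil.
rewrite big_cons; apply: eq_logder (logder_polyM (h i) IHr) => // n.
by rewrite big_cons.
Qed.

Lemma deriv_prod (I : finType) (F : I -> {poly R}) :
  (\prod_i F i)^`() = \sum_i (F i)^`() * \prod_(j | j != i) F j.
Proof.
have h (r : seq I) : uniq r -> (\prod_(i <- r) F i)^`() =
    \sum_(i <- r) (F i)^`() * \prod_(j <- r | j != i) F j.
  elim: r => [|i r IHr /= /andP[nir ur]]; first by rewrite !big_nil derivC.
  rewrite !big_cons derivM IHr // eqxx /=; congr (_ * _ + _).
    rewrite big_seq [RHS]big_seq_cond; apply: eq_bigl => j.
    by case jr: (j \in r) => //=; symmetry; apply: contraNneq nir => <-.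
  rewrite big_distrr big_seq [RHS]big_seq; apply: eq_bigr => j jr /=.
  by rewrite big_cons; case: eqP jr nir => [<- ->|_ _ _] //; rewrite mulrCA.
by apply: h; exact: index_enum_uniq.
Qed.

(** Jacobi's formula.  The derivative of a product of n entries is a sum of n
    products in which one entry is derived; summing over permutations gives the
    determinants with one derived row, and expanding along that row produces the
    adjugate. *)
Lemma deriv_det n (P : 'M[{poly R}]_n) :
  (\det P)^`() = \tr (map_mx (@deriv R) P *m \adj P).
Proof.
pose Pr i := \matrix_(k, j) (if k == i then (P k j)^`() else P k j).
transitivity (\sum_i \det (Pr i)).
  rewrite /determinant raddf_sum /= exchange_big /=; apply: eq_bigr => s _.
  have -> (p : {poly R}) : ((-1) ^+ s * p)^`() = (-1) ^+ s * p^`().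
    by case: (odd_perm s); rewrite ?expr0 ?expr1 ?mul1r // !mulN1r derivN.
  rewrite deriv_prod big_distrr; apply: eq_bigr => i _ /=; congr (_ * _).
  rewrite [RHS](bigD1 i) //= mxE eqxx; congr (_ * _).
  by apply: eq_bigr => j /negbTE ji; rewrite mxE ji.
apply: eq_bigr => i _.
rewrite (expand_det_row _ i) mxE; apply: eq_bigr => j _.
rewrite !mxE eqxx; congr (_ * _).
rewrite /cofactor; congr (_ * \det _).
apply/matrixP=> k l; rewrite !mxE [_ == i]eq_sym.
by rewrite (negbTE (neq_lift _ _)).
Qed.

(** From t P' = T P follows t (det P)' = tr(adj(P) T P) = tr(T) det P. *)
Lemma det_logder n (T M : nat -> 'M[R]_n) (P : 'M[{poly R}]_n) :
  (forall i j k, (P i j)`_k = M k i j) -> logder T M ->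
  logder (fun k => \tr (T k)) (fun k => (\det P)`_k).
Proof.
move=> hP hT; apply/logderP => N.
have lowdet : low_eq N (trunc N (fun k => (\det P)`_k)) (\det P).
  by move=> k lek; rewrite trunc_coef.
apply: low_eq_trans (low_eq_Xderiv lowdet) _.
apply: low_eq_trans (low_eqM (@low_eq_refl N _) (low_eq_sym lowdet)).
(* T truncated, as a matrix of polynomials *)
pose TN := \matrix_(i, j) trunc N (no_const (fun k => T k i j)).
have -> : trunc N (no_const (fun k => \tr (T k))) = \tr TN.
  apply/polyP=> k; rewrite coef_sum coef_poly.
  rewrite /no_const; case: ifP => lek; last first.
    by rewrite big1 // => i _; rewrite mxE coef_poly lek.
  case: ifP => k0; last first.
    by apply: eq_bigr => i _; rewrite mxE coef_poly lek /no_const k0.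
  by rewrite big1 // => i _; rewrite mxE coef_poly lek /no_const k0.
have -> : \tr TN * \det P = \tr ((TN *m P) *m \adj P).
  by rewrite -mulmxA mul_mx_adj mul_mx_scalar mxtraceZ mulrC.
have -> : 'X * (\det P)^`() = \tr ('X *: map_mx (@deriv R) P *m \adj P).
  by rewrite deriv_det -scalemxAl mxtraceZ.
apply: low_eq_sum => i; rewrite !mxE; apply: low_eq_sum => j.
apply: low_eqM; last exact: low_eq_refl.
move=> k lek; rewrite !mxE coefXderiv hP.
have := congr1 (fun A : 'M_n => A i j) (hT k).
rewrite mulmxnE => ->; rewrite summxE coef_sum.
under eq_bigr => l _ do rewrite mxE.
rewrite exchange_big; apply: eq_bigr => l _ /=; rewrite mxE.
symmetry; apply: (@coef_no_constM N (fun k => T k i l) (fun k => M k l j)).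
  by [].
by move=> r _; rewrite hP.
Qed.

(** The matrix 1 - t B, whose determinant is the inverse characteristic polynomial
    of B. *)
Definition charseries n (B : 'M[R]_n) : 'M[{poly R}]_n :=
  1%:M - map_mx polyC B *m ('X)%:M.

Lemma charseries_coef n (B : 'M[R]_n) i j k :
  (charseries B i j)`_k =
    (if k == 0%N then 1%:M else if k == 1%N then - B else 0) i j.
Proof.
rewrite /charseries mul_mx_scalar !mxE coefB coefXM coefMn coef1.
by case: k => [|[|k]] /=; rewrite ?coefC ?mxE /= ?mul0rn ?subr0 ?sub0r ?oppr0.
Qed.

(** The series of matrices P = 1 - t B satisfies t P' = T P with
    T = - sum_(k >= 1) B^k t^k, because T = - t B (1 - t B)^-1. *)
Lemma det_charseries_logder n (B : 'M[R]_n) :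
  logder (fun k => - \tr (B ^+ k)) (fun k => (\det (charseries B))`_k).
Proof.
pose M k : 'M[R]_n := if k == 0%N then 1%:M else if k == 1%N then - B else 0.
have hT : logder (fun k => - B ^+ k) M.
  case=> [|[|n']]; first by rewrite big_ord0 mulr0n.
    by rewrite big_ord1 /M /= mulr1 expr1.
  rewrite 2!big_ord_recr big1 /= => [|i _]; last first.
    have ne0 : (n'.+2 - i.+1 == 0)%N = false.
      by rewrite subSS subn_eq0 leqNgt ltnS ltnW.
    have ne1 : (n'.+2 - i.+1 == 1)%N = false.
      by rewrite subSS subSn ?eqSS ?subn_eq0 ?(ltnW (ltn_ord i)) // leqNgt ltn_ord.
    by rewrite /M ne0 ne1 mulr0.
  rewrite /M subnn subSnn mul0rn /= add0r.
  by rewrite mulrNN mulr1 [B ^+ n'.+2]exprSr subrr.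
apply: eq_logder (det_logder (charseries_coef B) hT) => // k.
by rewrite raddfN.
Qed.

Lemma det_charseries0 n (B : 'M[R]_n) : (\det (charseries B))`_0 = 1.
Proof.
rewrite -horner_coef0 -[LHS]/(horner_eval 0 _) -det_map_mx.
rewrite [X in \det X](_ : _ = 1%:M) ?det1 //.
apply/matrixP=> i j; rewrite mxE [LHS]horner_coef0.
by rewrite charseries_coef.
Qed.

End LowCoefficients.

(** * Semi-simple rings and finite bases *)

(** A complement J of I splits 1 as e + z, and x z lies both in I and in J for x
    in I. *)
Lemma semisimple_right_id (R : pzRingType) (I : set R) :
  semisimple_ring R -> left_ideal I ->
  exists2 e, I e & forall x, I x -> x * e = x.
Proof.
move=> ssR lI; have [J [[J0 JD JM] IJ IJ0]] := ssR I lI.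
case: lI => I0 ID IM.
have [e Ie [z Jz e1]] := IJ 1.
exists e => // x Ix; apply/eqP; rewrite eq_sym -subr_eq0; apply/eqP.
have xz : x - x * e = x * z by rewrite -{1}[x]mulr1 e1 mulrDr addrAC subrr add0r.
apply: IJ0; last by rewrite xz; apply: JM.
by apply: ID => //; rewrite -mulNr; apply: IM.
Qed.

(** The right identity e of the ideal I is also a left identity: for x in I, the
    element x - e x is killed by I on the left, and the set L of those elements
    of I is a left ideal with L L = 0, hence zero since it has a right identity in
    L. *)
Lemma semisimple_two_sided (R : pzRingType) (I : set R) :
  semisimple_ring R -> left_ideal I -> (forall a x, I x -> I (x * a)) ->
  exists e, [/\ I e, forall x, I x -> e * x = x /\ x * e = x
    & forall r, e * r = r * e].
Proof.
move=> ssR lI IMr; have [I0 ID IM] := lI.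
have [e Ie xe] := semisimple_right_id ssR lI.
have IB x y : I x -> I y -> I (x - y).
  by move=> Ix Iy; apply: ID => //; rewrite -mulN1r; apply: IM.
(* the left ideal of the elements of I killed by I *)
pose L : set R := fun l => I l /\ forall i, I i -> i * l = 0.
have lL : left_ideal L.
  split; first by split=> // i _; rewrite mulr0.
    move=> x y [Ix x0] [Iy y0]; split; first exact: ID.
    by move=> i Ii; rewrite mulrDr x0 ?y0 ?addr0.
  move=> a x [Ix x0]; split; first exact: IM.
  by move=> i Ii; rewrite mulrA x0 //; apply: IMr.
have [u [Iu Iu0] xu] := semisimple_right_id ssR lL.
have L0 l : L l -> l = 0.
  by move=> Ll; rewrite -(xu _ Ll) Iu0 //; case: Ll.
have ex x : I x -> e * x = x.
  move=> Ix; apply/eqP; rewrite eq_sym -subr_eq0; apply/eqP/L0; split.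
    by apply: IB => //; apply: IM.
  by move=> i Ii; rewrite mulrBr mulrA xe // subrr.
exists e; split=> // [x Ix|r]; first by split; [apply: ex | apply: xe].
by rewrite -(xe _ (IMr r _ Ie)) -[RHS](ex _ (IM r _ Ie)) mulrA.
Qed.

Section FiniteBasis.
Variable F : fieldType.

(** Remove from a generating family a vector that appears in a linear relation,
    until the family is free. *)
Lemma fin_gen_basis (V : lmodType F) m (x : 'I_m -> V) :
  (forall v, exists c : 'I_m -> F, v = \sum_i c i *: x i) ->
  exists n (b : 'I_n -> V), forall v,
    exists! c : {ffun 'I_n -> F}, v = \sum_i c i *: b i.
Proof.
elim: m x => [|m IHm] x gen.
  exists 0%N, x => v; have [c ->] := gen v.
  exists [ffun i => c i]; split; first by apply: eq_bigr => i; rewrite ffunE.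
  by move=> c' _; apply/ffunP=> -[].
have [free|] := pselect (forall d : 'I_m.+1 -> F,
    \sum_i d i *: x i = 0 -> forall i, d i = 0).
  exists m.+1, x => v; have [c vE] := gen v.
  exists [ffun i => c i]; split.
    by rewrite vE; apply: eq_bigr => i; rewrite ffunE.
  move=> c' v'E; apply/ffunP=> i; rewrite ffunE; apply/eqP; rewrite -subr_eq0.
  apply/eqP/(free (fun i => c i - c' i)).
  by under eq_bigr do rewrite scalerBl; rewrite sumrB -vE -v'E subrr.
move=> /existsNP[d /not_implyP[d0 /existsNP[i0 /eqP di0]]].
apply: (IHm (fun i => x (lift i0 i))) => v; have [c ->] := gen v.
exists (fun i => c (lift i0 i) - c i0 * (d i0)^-1 * d (lift i0 i)).
have xi0 : x i0 = - ((d i0)^-1 *: \sum_i d (lift i0 i) *: x (lift i0 i)).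
  move: d0; rewrite (bigD1_ord i0) //= => /eqP; rewrite addr_eq0 => /eqP e.
  by rewrite -[LHS]scale1r -(mulVf di0) -scalerA e scalerN.
rewrite (bigD1_ord i0) //= xi0 scalerN scalerA addrC scaler_sumr -sumrB.
by apply: eq_bigr => i _; rewrite scalerA scalerBl.
Qed.

Section ActionBasis.
Variables (V : zmodType) (act : F -> V -> V).
Hypotheses (actA : forall a b v, act a (act b v) = act (a * b) v)
  (act1 : left_id 1 act) (actDr : right_distributive act +%R)
  (actDl : forall v, {morph act^~ v : a b / a + b}).

(** An alias of V that carries the module structure given by act, so that subfields
    of an algebra can act by multiplication on either side. *)
Definition action_module : Type := V.
HB.instance Definition _ := GRing.Zmodule.on action_module.
HB.instance Definition _ :=
  GRing.Zmodule_isLmodule.Build F action_module actA act1 actDr actDl.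

Lemma fin_gen_action_basis m (x : 'I_m -> V) :
  (forall v, exists c : 'I_m -> F, v = \sum_i act (c i) (x i)) ->
  exists n (b : 'I_n -> V), forall v,
    exists! c : {ffun 'I_n -> F}, v = \sum_i act (c i) (b i).
Proof. exact: (@fin_gen_basis action_module). Qed.
End ActionBasis.

(** Take a subspace of maximal dimension on which P holds.  This lets ideals be
    handled as predicates. *)
Lemma vspace_of_closed (V : vectType F) (P : V -> Prop) :
  P 0 -> (forall k x y, P x -> P y -> P (k *: x + y)) ->
  exists W : {vspace V}, forall x, x \in W <-> P x.
Proof.
move=> P0 Plin.
pose Q n := `[< exists W : {vspace V}, \dim W = n /\ forall x, x \in W -> P x >].
have exQ : exists n, Q n.
  exists 0%N; apply/asboolP; exists 0%VS; rewrite dimv0; split=> // x.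
  by rewrite memv0 => /eqP->.
have ubQ n : Q n -> (n <= \dim (fullv : {vspace V}))%N.
  by move=> /asboolP[W [<- _]]; apply: dimvS; apply: subvf.
have [n /asboolP[W [dW WP]] max] := ex_maxnP exQ ubQ.
exists W => x; split; first exact: WP.
move=> Px; apply: contrapT => /negP nWx.
have /max : Q (\dim (W + <[x]>)%VS).
  apply/asboolP; exists (W + <[x]>)%VS; split=> // _ /memv_addP[w Ww [_ /vlineP[k ->] ->]].
  by rewrite addrC; apply: Plin => //; apply: WP.
rewrite -dW leqNgt => /negP; apply.
rewrite ltn_neqAle dimvS ?addvSl // andbT.
apply: contraNneq nWx => dE.
have /eqP-> : W == (W + <[x]>)%VS by rewrite eqEdim addvSl dE leqnn.
by rewrite (subvP (addvSr _ _)) // memv_line.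
Qed.

(** Commutative subalgebras with inverses become types of fields; their identity e
    may differ from 1, so that phi is additive and multiplicative but not a
    morphism of unital rings. *)
Lemma subfield_type (A : falgType F) (U : {vspace A}) (e : A) :
  e \in U -> e != 0 -> (forall x, x \in U -> x * e = x) ->
  (forall x y, x \in U -> y \in U -> x * y \in U) ->
  (forall x y, x \in U -> y \in U -> x * y = y * x) ->
  (forall x, x \in U -> x != 0 -> exists2 y, y \in U & x * y = e) ->
  exists (E : fieldType) (phi : {additive E -> A}),
    [/\ phi 1 = e, {morph phi : x y / x * y}
      & forall x, x \in U <-> exists y, phi y = x].
Proof.
move=> Ue e0 xe UM UC Uinv.
have aU : is_aspace U.
  apply/andP; split; last by apply/prodvP.
  by apply/has_algidP; exists e; split=> // u Uu; rewrite xe // UC // xe.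
pose B := ASpace aU.
have algidE : algid B = e.
  by rewrite -[LHS](xe _ (memv_algid B)) (@algidl _ _ B).
have mulC : commutative (@GRing.mul (subvs_of B)).
  by move=> x y; apply/val_inj/UC; apply: subvsP.
pose cM := GRing.PzRing_hasCommutativeMul.Build (subvs_of B) mulC.
pose cU : comUnitRingType := HB.pack (subvs_of B) cM.
have unitM : GRing.ComUnitRing_isField cU.
  constructor=> x nzx; apply/unitrP.
  have nzx' : vsval x != 0 by apply: contra nzx => /eqP vx; apply/eqP/val_inj.
  have [y Uy xy] := Uinv _ (subvsP x) nzx'.
  have xyE : (x : subvs_of B) * (Subvs Uy : subvs_of B) = 1.
    by apply: val_inj; rewrite /= xy algidE.
  exists (Subvs Uy); split=> //; rewrite -[RHS]xyE; exact: mulC.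
pose E : fieldType := HB.pack cU unitM.
exists E, (vsval : {additive subvs_of B -> A}); split=> // x.
by split=> [Ux | [y <-]]; [exists (Subvs Ux) | apply: subvsP].
Qed.

End FiniteBasis.

(** * Ideals and centre of a simple algebra *)

Section SimpleAlgebra.
Variables (K : fieldType) (A : falgType K).
Hypothesis simpleA : simple_alg A.

Lemma simple_ideal_full (P : A -> Prop) a :
  P 0 -> (forall x y, P x -> P y -> P (x + y)) ->
  (forall c x, P x -> P (c * x)) -> (forall c x, P x -> P (x * c)) ->
  P a -> a != 0 -> forall x, P x.
Proof.
move=> P0 PD Pl Pr Pa a0 x.
have [|W WP] := @vspace_of_closed _ A P P0.
  by move=> k u v Pu Pv; apply: PD => //; rewrite -[u]mul1r scalerAl; apply: Pl.
case: (simpleA (U := W)).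
- by apply/prodvP=> u v _ /WP Pv; apply/WP/Pl.
- by apply/prodvP=> u v /WP Pu _; apply/WP/Pr.
- by move=> W0; move: Pa => /WP; rewrite W0 memv0 (negbTE a0).
- by move=> Wf; apply/WP; rewrite Wf memvf.
Qed.

(** The elements of this form are a two-sided ideal that contains a. *)
Lemma simple_ideal_gen (a : A) : a != 0 ->
  forall x, exists s : seq (A * A), x = \sum_(p <- s) p.1 * a * p.2.
Proof.
move=> a0; apply: (simple_ideal_full (a := a)) => //.
- by exists [::]; rewrite big_nil.
- by move=> _ _ [s1 ->] [s2 ->]; exists (s1 ++ s2); rewrite big_cat.
- move=> c _ [s ->]; exists [seq (c * p.1, p.2) | p <- s].
  by rewrite big_map mulr_sumr; apply: eq_bigr => p _; rewrite !mulrA.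
- move=> c _ [s ->]; exists [seq (p.1, p.2 * c) | p <- s].
  by rewrite big_map mulr_suml; apply: eq_bigr => p _; rewrite !mulrA.
- by exists [:: (1, 1)]; rewrite big_seq1 mul1r mulr1.
Qed.

Lemma simple_rmorph_inj (R : pzRingType) (S : {rmorphism A -> R}) :
  (1 : R) != 0 -> injective S.
Proof.
move=> R10 x y Sxy; apply/eqP; rewrite -subr_eq0; apply: contraNT R10 => xy0.
have /(_ 1) : forall z, S z = 0.
  apply: (@simple_ideal_full _ (x - y)) => //.
  - exact: rmorph0.
  - by move=> u v Su Sv; rewrite rmorphD Su Sv addr0.
  - by move=> c u Su; rewrite rmorphM Su mulr0.
  - by move=> c u Su; rewrite rmorphM Su mul0r.
  - by rewrite rmorphB Sxy subrr.
by rewrite rmorph1 => ->.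
Qed.

Lemma centreP (z : A) : z \in centre A <-> forall x, z * x = x * z.
Proof.
rewrite /centre memv_cap memvf /=; split.
  by move=> /centvP h x; apply: h; rewrite memvf.
by move=> h; apply/centvP => x _; apply: h.
Qed.

Lemma centreM (x y : A) : x \in centre A -> y \in centre A -> x * y \in centre A.
Proof.
by move=> /centreP hx /centreP hy; apply/centreP => u;
   rewrite -mulrA hy mulrA hx mulrA.
Qed.

Lemma centre1 : 1 \in centre A.
Proof. by apply/centreP => x; rewrite mul1r mulr1. Qed.

(** Writing 1 as a sum of products p z q with z central gives 1 = z w, where w is the
    sum of the products p q. *)
Lemma centre_inv (z : A) : z \in centre A -> z != 0 ->
  exists2 w, w \in centre A & z * w = 1.
Proof.
move=> /centreP Zz z0; have [s s1] := simple_ideal_gen z0 1.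
pose w := \sum_(p <- s) p.1 * p.2.
have zw : z * w = 1.
  rewrite s1 mulr_sumr; apply: eq_bigr => p _.
  by rewrite mulrA Zz.
exists w => //; apply/centreP => x.
have wz : w * z = 1 by rewrite -Zz.
have e : z * (w * x) = z * (x * w) by rewrite mulrA zw mul1r mulrA Zz -mulrA zw mulr1.
by rewrite -[w * x]mul1r -wz -mulrA e mulrA wz mul1r.
Qed.

Lemma centre_field : exists (Z : fieldType) (phi : {rmorphism Z -> A}),
  forall z, z \in centre A <-> exists y, phi y = z.
Proof.
have [||||Z [phi [phi1 phiM phiZ]]] :=
    @subfield_type K A (centre A) 1 centre1 (oner_neq0 A).
- by move=> x _; rewrite mulr1.
- exact: centreM.
- by move=> x y /centreP Zx _; apply: Zx.
- exact: centre_inv.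
pose mM := GRing.isMonoidMorphism.Build Z A phi (phi1, phiM).
pose phi' : {rmorphism Z -> A} := HB.pack (phi : Z -> A) mM phi.
by exists Z, phi'.
Qed.

Lemma minimal_left_ideal : exists (V : A -> Prop),
  [/\ V 0, forall x y, V x -> V y -> V (x + y) & forall c x, V x -> V (c * x)] /\
  (exists2 v, V v & v != 0) /\
  forall P : A -> Prop, P 0 -> (forall x y, P x -> P y -> P (x + y)) ->
    (forall c x, P x -> P (c * x)) -> (forall x, P x -> V x) ->
    (exists2 v, P v & v != 0) -> forall x, V x -> P x.
Proof.
pose Q n := `[< exists W : {vspace A},
  [/\ \dim W = n, (fullv * W <= W)%VS & W != 0%VS] >].
have exQ : exists n, Q n.
  exists (\dim (fullv : {vspace A})); apply/asboolP; exists fullv; split=> //.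
    exact: subvf.
  by rewrite -dimv_eq0 -lt0n dimvf FalgType_proper.
have [n /asboolP[W [dW WM W0]] min] := ex_minnP exQ.
exists (fun x => x \in W); split; [split|split].
- exact: mem0v.
- by move=> x y; apply: memvD.
- by move=> c x Wx; apply: (subvP WM); rewrite memv_mul ?memvf.
- by exists (vpick W); rewrite ?memv_pick // vpick0.
move=> P P0 PD PM PW [v Pv v0].
have [|U UP] := @vspace_of_closed _ A P P0.
  by move=> k x y Px Py; apply: PD => //; rewrite -[x]mul1r scalerAl; apply: PM.
have UW : (U <= W)%VS by apply/subvP => x /UP/PW.
have : Q (\dim U).
  apply/asboolP; exists U; split=> //.
    by apply/prodvP => c x _ /UP Px; apply/UP/PM.
  by apply: contraNneq v0 => U0; move: Pv => /UP; rewrite U0 memv0.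
move=> /min; rewrite -dW => le x Wx; apply/UP.
by have /eqP-> : U == W by rewrite eqEdim UW.
Qed.

(** Among the commutative subspaces contained in D, one of maximal dimension
    contains every element of D commuting with it. *)
Lemma maximal_commutative (D : A -> Prop) :
  D 0 -> (forall k x y, D x -> D y -> D (k *: x + y)) ->
  exists U : {vspace A}, forall x,
    x \in U <-> D x /\ forall y, y \in U -> x * y = y * x.
Proof.
move=> D0 Dlin.
pose Q n := `[< exists W : {vspace A}, \dim W = n /\
  (forall x, x \in W -> D x) /\ forall x y, x \in W -> y \in W -> x * y = y * x >].
have exQ : exists n, Q n.
  exists 0%N; apply/asboolP; exists 0%VS; rewrite dimv0; split=> //; split.
    by move=> x; rewrite memv0 => /eqP->.
  by move=> x y; rewrite !memv0 => /eqP-> /eqP->.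
have ubQ n : Q n -> (n <= \dim (fullv : {vspace A}))%N.
  by move=> /asboolP[W [<- _]]; apply: dimvS; apply: subvf.
have [n /asboolP[W [dW [WD WC]]] max] := ex_maxnP exQ ubQ.
exists W => x; split; first by move=> Wx; split; [apply: WD|move=> y; apply: WC].
move=> [Dx xC]; apply: contrapT => /negP nWx.
have /max : Q (\dim (W + <[x]>)%VS).
  apply/asboolP; exists (W + <[x]>)%VS; split=> //; split.
    move=> _ /memv_addP[w Ww [_ /vlineP[k ->] ->]].
    by rewrite addrC; apply: Dlin => //; apply: WD.
  move=> _ _ /memv_addP[w Ww [_ /vlineP[k ->] ->]]
             /memv_addP[w' Ww' [_ /vlineP[k' ->] ->]].
  rewrite !mulrDl !mulrDr (WC w w') // -!scalerAl -!scalerAr (xC w) // (xC w') //.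
  by rewrite -!addrA; congr (_ + _); rewrite addrCA scalerA [k * k']mulrC -scalerA.
rewrite -dW leqNgt => /negP; apply.
rewrite ltn_neqAle dimvS ?addvSl // andbT.
apply: contraNneq nWx => dE.
have /eqP-> : W == (W + <[x]>)%VS by rewrite eqEdim addvSl dE leqnn.
by rewrite (subvP (addvSr _ _)) // memv_line.
Qed.

End SimpleAlgebra.

(** * Density for a minimal left ideal *)

(** V is a minimal left ideal A e, and phi embeds in e A e a maximal commutative
    subfield L, which acts on V by right multiplication. *)
Section Density.
Variables (K : fieldType) (A : falgType K) (V : A -> Prop) (e : A).
Variables (L : fieldType) (phi : {additive L -> A}).
Hypotheses (V0 : V 0) (VD : forall x y, V x -> V y -> V (x + y))
  (VM : forall c x, V x -> V (c * x)).
Hypothesis Vmin : forall P : A -> Prop, P 0 ->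
  (forall x y, P x -> P y -> P (x + y)) -> (forall c x, P x -> P (c * x)) ->
  (forall x, P x -> V x) -> (exists2 v, P v & v != 0) -> forall x, V x -> P x.
Hypotheses (Ve : V e) (e_neq0 : e != 0) (ee : forall x, V x -> x * e = x).
Hypotheses (phi1 : phi 1 = e) (phiM : {morph phi : x y / x * y}).
Hypotheses (phiV : forall l, V (phi l)) (ephi : forall l, e * phi l = phi l).
Hypothesis phi_max : forall d, V d -> e * d = d ->
  (forall l, d * phi l = phi l * d) -> exists l, phi l = d.

Let phiC x y : phi x * phi y = phi y * phi x.
Proof. by rewrite -!phiM mulrC. Qed.

Let Vphi x l : V x -> V (x * phi l). Proof. by move=> _; apply: VM. Qed.

Let VB x y : V x -> V y -> V (x - y).
Proof. by move=> Vx Vy; apply: VD => //; rewrite -mulN1r; apply: VM. Qed.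

Let Vsum (I : Type) (r : seq I) (F : I -> A) :
  (forall i, V (F i)) -> V (\sum_(i <- r) F i).
Proof. by move=> h; elim/big_ind: _. Qed.

(** The action on V of the element sum_p p.1 (x) p.2 of the tensor product of A
    and L. *)
Definition sandwich (o : seq (A * L)) v := \sum_(p <- o) p.1 * v * phi p.2.

Let sandwichV o v : V v -> V (sandwich o v).
Proof. by move=> Vv; apply: Vsum => p; apply: Vphi; apply: VM. Qed.

Let sandwich_cat o o' v : sandwich (o ++ o') v = sandwich o v + sandwich o' v.
Proof. by rewrite /sandwich big_cat. Qed.

Let sandwich_lmul c o v : sandwich [seq (c * p.1, p.2) | p <- o] v = c * sandwich o v.
Proof. by rewrite /sandwich big_map mulr_sumr; apply: eq_bigr => p _; rewrite !mulrA. Qed.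

Let sandwich_rmul l o v : sandwich [seq (p.1, p.2 * l) | p <- o] v = sandwich o v * phi l.
Proof.
by rewrite /sandwich big_map mulr_suml; apply: eq_bigr => p _; rewrite phiM mulrA.
Qed.

Let sandwichD o v w : sandwich o (v + w) = sandwich o v + sandwich o w.
Proof.
by rewrite /sandwich -big_split; apply: eq_bigr => p _ /=; rewrite mulrDr mulrDl.
Qed.

Let sandwich_phi o v l : sandwich o (v * phi l) = sandwich o v * phi l.
Proof.
rewrite /sandwich mulr_suml; apply: eq_bigr => p _.
by rewrite -!mulrA phiC.
Qed.

Let sandwich0 o : sandwich o 0 = 0.
Proof. by rewrite /sandwich big1 // => p _; rewrite mulr0 mul0r. Qed.

Let sandwichN o v : sandwich o (- v) = - sandwich o v.
Proof. by apply/eqP; rewrite -addr_eq0 -sandwichD addNr sandwich0. Qed.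

(** The values at u of the operators killing s are a left ideal contained in V:
    either zero or the whole of V. *)
Lemma sandwich_transitive (I : eqType) (b : I -> A) (s : seq I) u o0 :
  V u -> (forall i, i \in s -> sandwich o0 (b i) = 0) -> sandwich o0 u != 0 ->
  forall x, V x -> exists2 o,
    (forall i, i \in s -> sandwich o (b i) = 0) & sandwich o u = x.
Proof.
move=> Vu ko0 o0u; apply: Vmin.
- by exists [::]; rewrite /sandwich ?big_nil // => i _; rewrite big_nil.
- move=> _ _ [o ko <-] [o' ko' <-]; exists (o ++ o'); rewrite ?sandwich_cat // => i si.
  by rewrite sandwich_cat ko ?ko' ?addr0.
- move=> c _ [o ko <-]; exists [seq (c * p.1, p.2) | p <- o].
    by move=> i si; rewrite sandwich_lmul ko ?mulr0.
  by rewrite sandwich_lmul.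
- by move=> _ [o _ <-]; apply: sandwichV.
- by exists (sandwich o0 u) => //; exists o0.
Qed.

(** Jacobson's density argument, by induction on s.  If the operators killing s do
    not all kill the next vector u = b i, they map u onto V, and T u |-> T w is a
    well-defined endomorphism of V commuting with A and L.  It is the right
    multiplication by an element of L, by maximality of L; subtracting this
    multiple of u from w reduces to s. *)
Lemma density (I : eqType) (b : I -> A) (s : seq I) w :
  uniq s -> (forall i, V (b i)) -> V w ->
  (forall o, (forall i, i \in s -> sandwich o (b i) = 0) -> sandwich o w = 0) ->
  exists c : I -> L, w = \sum_(i <- s) b i * phi (c i).
Proof.
move=> + Vb; elim: s w => [|i s IHs] w /=.
  move=> _ Vw h; exists (fun=> 0); rewrite big_nil.
  rewrite -(h [:: (1, 1)]) // /sandwich big_seq1 mul1r phi1 ee //.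
move=> /andP[nis us] Vw h.
suff [c0 hc0] : exists c0, forall o, (forall j, j \in s -> sandwich o (b j) = 0) ->
    sandwich o (w - b i * phi c0) = 0.
  have [|c cE] := IHs _ us _ hc0; first by apply: VB => //; apply: Vphi.
  exists (fun j => if j == i then c0 else c j).
  rewrite big_cons eqxx -[LHS](subrK (b i * phi c0)) addrC cE; congr (_ + _).
  apply: eq_big_seq => j js.
  by case: eqP nis js => // -> /negP.
have [[o0 [ko0 o0i]]|] := pselect (exists o,
    (forall j, j \in s -> sandwich o (b j) = 0) /\ sandwich o (b i) != 0); last first.
  move=> none; exists 0 => o ko; rewrite raddf0 mulr0 subr0; apply: h => j.
  rewrite inE => /orP[/eqP->|]; last exact: ko.
  by apply/eqP/negPn/negP => oi; apply: none; exists o.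
(* T1 kills s and maps u to e, so that T and (T u) T1 agree on s and u *)
have [o1 ko1 o1i] := sandwich_transitive (Vb i) ko0 o0i Ve.
pose d := sandwich o1 w.
have od o : (forall j, j \in s -> sandwich o (b j) = 0) ->
    sandwich o w = sandwich o (b i) * d.
  move=> ko; apply/eqP; rewrite -subr_eq0 -mulNr -sandwich_lmul -sandwich_cat.
  apply/eqP/h => j.
  rewrite sandwich_cat sandwich_lmul inE => /orP[/eqP->|js]; last first.
    by rewrite ko // ko1 // mulr0 addr0.
  by rewrite o1i mulNr ee ?subrr //; apply: sandwichV.
have Vd : V d by apply: sandwichV.
have [||c cE] := phi_max (VM e Vd).
- by rewrite mulrA ee.
- move=> l; rewrite -mulrA [RHS]mulrA ee //.
  have -> : d * phi l = phi l * d.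
    rewrite -{2}(ephi l) -o1i -sandwich_rmul -od; first by rewrite sandwich_rmul.
    by move=> j js; rewrite sandwich_rmul ko1 ?mul0r.
  by rewrite mulrA ephi.
exists c => o ko; rewrite sandwichD sandwichN sandwich_phi od // cE mulrA ee ?subrr //.
exact: sandwichV.
Qed.

(** V is finite-dimensional over K, and K e is contained in L by maximality. *)
Lemma left_ideal_basis : exists n (b : 'I_n -> A), (forall i, V (b i)) /\
  forall v, V v -> exists! c : {ffun 'I_n -> L}, v = \sum_i b i * phi (c i).
Proof.
have [|U UV] := @vspace_of_closed _ A V V0.
  by move=> k x y Vx Vy; apply: VD => //; rewrite -[x]mul1r scalerAl; apply: VM.
have UVphi u l : u \in U -> u * phi l \in U by move=> Uu; apply/UV/VM.
pose act (l : L) (v : subvs_of U) : subvs_of U := vsproj U (vsval v * phi l).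
have actE l v : vsval (act l v) = vsval v * phi l.
  by rewrite vsprojK // UVphi // subvsP.
have actA x y v : act x (act y v) = act (x * y) v.
  by apply: val_inj; rewrite /= !actE -mulrA -phiM mulrC.
have act1 : left_id 1 act.
  by move=> v; apply: val_inj; rewrite /= actE phi1 ee //; apply/UV/subvsP.
have actDr : right_distributive act +%R.
  by move=> l x y; apply: val_inj; rewrite /= actE !linearD /= !actE mulrDl.
have actDl v : {morph act^~ v : x y / x + y}.
  by move=> x y; apply: val_inj; rewrite /= !actE raddfD mulrDr.
have kphi (k : K) : exists l, phi l = k *: e.
  apply: phi_max.
  - by rewrite -[e]mul1r scalerAl; apply: VM.
  - by rewrite -scalerAr ee.
  - by move=> l; rewrite -scalerAl -scalerAr -phi1 phiC.
have [f fE] := choice kphi.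
have gen v : exists c : 'I_(\dim U) -> L,
    v = \sum_i act (c i) (vsproj U (vbasis U)`_i).
  exists (fun i => f (coord (vbasis U) i (vsval v))); apply: val_inj.
  rewrite [RHS]linear_sum /= {1}(coord_vbasis (subvsP v)).
  apply: eq_bigr => i _; rewrite actE fE vsprojK ?vbasis_mem ?mem_nth ?size_tuple //.
  by rewrite -scalerAr ee //; apply/UV; rewrite vbasis_mem ?mem_nth ?size_tuple.
have [n [b hb]] := fin_gen_action_basis actA act1 actDr actDl gen.
exists n, (fun i => vsval (b i)); split; first by move=> i; apply/UV/subvsP.
move=> v /UV Uv; have [c [vE cU]] := hb (vsproj U v).
have actsum (d : {ffun 'I_n -> L}) :
    vsval (\sum_i act (d i) (b i)) = \sum_i vsval (b i) * phi (d i).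
  by rewrite linear_sum; apply: eq_bigr => i _; exact: actE.
exists c; split; first by rewrite -actsum -vE vsprojK.
move=> d dE; apply: cU; apply: val_inj.
by rewrite [RHS]actsum -dE; exact: vsprojK.
Qed.

(** The matrices of the left multiplications in a basis of V over L.  By density,
    some operator maps a given basis vector to another one and kills the rest, so
    that each elementary matrix is an L-combination of images of A. *)
Lemma dense_representation : exists n (rho : {rmorphism A -> 'M[L]_n}),
  [/\ (0 < n)%N, forall z, z \in centre A -> is_scalar_mx (rho z)
    & forall B : 'M[L]_n, exists c : A -> L,
      B = \sum_(x <- vbasis (fullv : {vspace A})) c x *: rho x].
Proof.
have [n [b [Vb hb]]] := left_ideal_basis.
have hc v : exists c : {ffun 'I_n -> L}, V v -> v = \sum_i b i * phi (c i).
  have [Vv|nVv] := pselect (V v); last by exists [ffun=> 0].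
  by have [c [cE _]] := hb v Vv; exists c.
have [crd crdE] := choice hc.
have uniq_crd (c d : 'I_n -> L) :
    \sum_i b i * phi (c i) = \sum_i b i * phi (d i) -> c =1 d.
  move=> cd; have [|f [fE fU]] := hb (\sum_i b i * phi (c i)).
    by apply: Vsum => i; apply: Vphi.
  have fc : f = [ffun i => c i].
    by apply: fU; apply: eq_bigr => i _; rewrite ffunE.
  have fd : f = [ffun i => d i].
    by apply: fU; rewrite cd; apply: eq_bigr => i _; rewrite ffunE.
  move=> i; have := congr1 (fun f : {ffun _ -> _} => f i) (etrans (esym fc) fd).
  by rewrite !ffunE.
pose rho a := \matrix_(i, j) crd (a * b j) i : 'M[L]_n.
have rhoE a j : a * b j = \sum_i b i * phi (rho a i j).
  rewrite [LHS]crdE; first by apply: eq_bigr => i _; rewrite mxE.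
  exact: VM.
have rhoP a (M : 'M[L]_n) :
    (forall j, a * b j = \sum_i b i * phi (M i j)) -> rho a = M.
  by move=> h; apply/matrixP => i j; move: i; apply: uniq_crd; rewrite -rhoE -h.
have rho_zmod : zmod_morphism rho.
  move=> x y; apply: rhoP => j; rewrite mulrBl !rhoE -sumrB.
  by apply: eq_bigr => i _; rewrite !mxE raddfB mulrBr.
have rho1 : rho 1 = 1.
  apply: rhoP => j; rewrite mul1r (bigD1 j) //= mxE eqxx phi1 ee //.
  by rewrite big1 ?addr0 // => i /negbTE ij; rewrite mxE ij raddf0 mulr0.
have rhoM : {morph rho : x y / x * y}.
  move=> x y; apply: rhoP => j; rewrite -mulrA rhoE mulr_sumr.
  under eq_bigr => k _ do rewrite mulrA rhoE mulr_suml.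
  rewrite exchange_big; apply: eq_bigr => i _ /=.
  rewrite mxE raddf_sum mulr_sumr; apply: eq_bigr => k _.
  by rewrite -mulrA phiM.
pose zm := GRing.isZmodMorphism.Build A 'M[L]_n rho rho_zmod.
pose mm := GRing.isMonoidMorphism.Build A 'M[L]_n rho (rho1, rhoM).
pose R : {rmorphism A -> 'M[L]_n} := HB.pack rho zm mm.
exists n, R; split=> /=.
- rewrite lt0n; apply: contra e_neq0 => /eqP n0; rewrite (crdE e Ve) big1 // => i _.
  by have := ltn_ord i; rewrite {2}n0.
- move=> z /centreP Zz.
  have [||l lE] := phi_max (VM z Ve).
  + by rewrite mulrA -Zz -mulrA ee.
  + by move=> l; rewrite -mulrA ephi mulrA -[phi l * z]Zz -mulrA ee.
  apply/is_scalar_mxP; exists l; apply: rhoP => j; rewrite (bigD1 j) //= mxE eqxx.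
  rewrite big1 => [|i /negbTE ij]; last by rewrite mxE ij raddf0 mulr0.
  by rewrite addr0 mulr1n lE mulrA -Zz ee //; apply: VM.
pose Q B := exists c : A -> L, B = \sum_(x <- vbasis (fullv : {vspace A})) c x *: rho x.
have Q0 : Q 0 by exists (fun=> 0); rewrite big1 // => x _; rewrite scale0r.
have QD B B' : Q B -> Q B' -> Q (B + B').
  move=> [c ->] [d ->]; exists (fun x => c x + d x).
  by rewrite -big_split; apply: eq_bigr => x _ /=; rewrite scalerDl.
have QZ l B : Q B -> Q (l *: B).
  move=> [c ->]; exists (fun x => l * c x).
  by rewrite scaler_sumr; apply: eq_bigr => x _; rewrite scalerA.
have Qsum (I : Type) (r : seq I) (F : I -> 'M[L]_n) :
    (forall i, Q (F i)) -> Q (\sum_(i <- r) F i).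
  by move=> h; elim/big_ind: _.
have rhoZ k a : exists l, rho (k *: a) = l *: rho a.
  have [|||l lE] := phi_max (d := k *: e).
  + by rewrite -[e]mul1r scalerAl; apply: VM.
  + by rewrite -scalerAr ee.
  + by move=> l; rewrite -scalerAl -scalerAr -phi1 phiC.
  exists l; apply: rhoP => j; rewrite -scalerAl rhoE scaler_sumr.
  apply: eq_bigr => i _; have -> : (l *: rho a) i j = l * rho a i j by rewrite mxE.
  rewrite phiM lE -scalerAl ephi.
  by rewrite scalerAr.
have Qrho a : Q (rho a).
  rewrite (coord_vbasis (memvf a)) [rho _](raddf_sum R).
  apply: (Qsum) => i /=.
  have [l ->] := rhoZ (coord (vbasis fullv) i a) (vbasis fullv)`_i.
  apply: (QZ); set x := _`_i; have Xx : x \in (vbasis (fullv : {vspace A}) : seq A).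
    by rewrite mem_nth ?size_tuple.
  exists (fun y => (y == x)%:R); rewrite (bigD1_seq x) //=; last first.
    by apply: free_uniq; apply: basis_free (vbasisP _).
  by rewrite eqxx scale1r big1 ?addr0 // => y /negbTE->; rewrite scale0r.
move=> B; rewrite [B]matrix_sum_delta; apply: (Qsum) => k; apply: (Qsum) => i; apply: (QZ).
pose s := [seq j <- enum 'I_n | j != i].
have [o0 [ko0 o0i]] : exists o,
    (forall j, j \in s -> sandwich o (b j) = 0) /\ sandwich o (b i) != 0.
  apply: contrapT => none.
  have [||c cE] := @density _ b s (b i) _ Vb (Vb i).
  + by apply: filter_uniq; apply: enum_uniq.
  + by move=> o ko; apply/eqP/negPn/negP => oi; apply: none; exists o.
  have /(_ i) : (fun j => (j == i)%:R) =1 (fun j => if j == i then 0 else c j).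
    apply: uniq_crd; rewrite [LHS](bigD1 i) //= [RHS](bigD1 i) //= eqxx phi1 ee //.
    rewrite raddf0 mulr0 add0r big1 ?addr0; last first.
      by move=> j /negbTE ji; rewrite ji raddf0 mulr0.
    rewrite cE big_filter big_enum_cond; apply: eq_bigr => j /negbTE ji.
    by rewrite ji.
  by rewrite eqxx => /eqP; rewrite oner_eq0.
have [o ko oi] := sandwich_transitive (Vb i) ko0 o0i (Vb k).
suff -> : delta_mx k i = \sum_(p <- o) p.2 *: rho p.1.
  by apply: (Qsum) => p; apply: (QZ).
apply/matrixP => r j; move: r; apply: uniq_crd.
have -> : \sum_r b r * phi ((\sum_(p <- o) p.2 *: rho p.1) r j) = sandwich o (b j).
  under eq_bigr => r _ do rewrite summxE raddf_sum mulr_sumr.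
  rewrite exchange_big; apply: eq_bigr => p _ /=.
  rewrite rhoE mulr_suml; apply: eq_bigr => r _.
  by rewrite mxE phiM phiC mulrA.
have [->|ji] := eqVneq j i.
  rewrite oi (bigD1 k) //= mxE !eqxx phi1 ee // big1 ?addr0 // => r /negbTE rk.
  by rewrite mxE rk raddf0 mulr0.
rewrite ko; last by rewrite mem_filter ji mem_enum.
by rewrite big1 // => r _; rewrite mxE (negbTE ji) andbF raddf0 mulr0.
Qed.

End Density.

(** A minimal left ideal V is of the form A e by Brauer's lemma: V V is not 0 since
    A is simple, so that V v = V for some v in V, and the solution e of e v = v is
    idempotent as no nonzero element of V kills v.  By minimality again, nonzero
    elements of e A e are invertible there, so that a maximal commutative subspace
    is a field. *)
Lemma simple_dense_representation (K : fieldType) (A : falgType K) :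
  simple_alg A -> exists (L : fieldType) n (rho : {rmorphism A -> 'M[L]_n}),
  [/\ (0 < n)%N, forall z, z \in centre A -> is_scalar_mx (rho z)
    & forall B : 'M[L]_n, exists c : A -> L,
      B = \sum_(x <- vbasis (fullv : {vspace A})) c x *: rho x].
Proof.
move=> simpleA.
have [V [[V0 VD VM] [[v0 Vv0 v0_neq0] Vmin]]] := minimal_left_ideal A.
have VB x y : V x -> V y -> V (x - y).
  by move=> Vx Vy; apply: VD => //; rewrite -mulN1r; apply: VM.
have Vimg v : V v -> (exists2 u, V u & u * v != 0) ->
    forall x, V x -> exists2 u, V u & u * v = x.
  move=> Vv [u Vu uv]; apply: Vmin.
  - by exists 0; rewrite ?mul0r.
  - by move=> _ _ [x Vx <-] [y Vy <-]; exists (x + y); rewrite ?mulrDl //; apply: VD.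
  - by move=> c _ [x Vx <-]; exists (c * x); rewrite ?mulrA //; apply: VM.
  - by move=> _ [x Vx <-]; apply: VM.
  - by exists (u * v) => //; exists u.
have [v Vv [u Vu uv]] : exists2 v, V v & exists2 u, V u & u * v != 0.
  apply: contrapT => none.
  have VV0 x y : V x -> V y -> x * y = 0.
    move=> Vx Vy; apply/eqP/negPn/negP => xy.
    by apply: none; exists y => //; exists x.
  have [s s1] := simple_ideal_gen simpleA v0_neq0 1.
  move: v0_neq0; rewrite -[v0]mul1r s1 mulr_suml big1 ?eqxx // => p _.
  by rewrite -!mulrA (VV0 v0) ?mulr0 //; apply: VM.
have [e Ve ev] := Vimg _ Vv (ex_intro2 _ _ u Vu uv) _ Vv.
have v_neq0 : v != 0 by apply: contraNneq uv => ->; rewrite mulr0.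
have e_neq0 : e != 0 by apply: contraNneq v_neq0 => e0; rewrite -ev e0 mul0r.
have ann x : V x -> x * v = 0 -> x = 0.
  move=> Vx xv; apply/eqP/negPn/negP => x0.
  suff : V u /\ u * v = 0 by move=> [_ /eqP]; apply/negP.
  apply: (Vmin (fun x => V x /\ x * v = 0)) Vu.
  - by rewrite mul0r.
  - by move=> y z [Vy yv] [Vz zv]; split; [apply: VD|rewrite mulrDl yv zv addr0].
  - by move=> c y [Vy yv]; split; [apply: VM|rewrite -mulrA yv mulr0].
  - by move=> y [].
  - by exists x.
have ee x : V x -> x * e = x.
  move=> Vx; apply/eqP; rewrite -subr_eq0; apply/eqP/ann.
    by apply: VB => //; apply: VM.
  by rewrite mulrBl -mulrA ev subrr.
have [||U UP] := @maximal_commutative K A (fun d => V d /\ e * d = d).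
- by rewrite mulr0.
- move=> k x y [Vx ex] [Vy ey]; split.
    by apply: VD => //; rewrite -[x]mul1r scalerAl; apply: VM.
  by rewrite mulrDr -scalerAr ex ey.
have UC x y : x \in U -> y \in U -> x * y = y * x by move=> /UP[_ h]; apply: h.
have Ue : e \in U.
  by apply/UP; split=> [|y /UP[[Vy ey] _]]; [rewrite ee | rewrite ey ee].
have Uinv x : x \in U -> x != 0 -> exists2 y, y \in U & x * y = e.
  have linv x' : V x' -> e * x' = x' -> x' != 0 ->
      exists y, [/\ V y, e * y = y & y * x' = e].
    move=> Vx ex x0; have [|y Vy yx] := Vimg x' Vx _ e Ve.
      by exists e; rewrite ?ex.
    exists (e * y); split; [exact: VM | by rewrite mulrA ee |].
    by rewrite -mulrA yx ee.
  move=> Ux x0; have /UP[[Vx ex] xU] := Ux.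
  have [y [Vy ey yx]] := linv x Vx ex x0.
  have y0 : y != 0 by apply: contraNneq e_neq0 => y0; rewrite -yx y0 mul0r.
  have [z [Vz ez zy]] := linv y Vy ey y0.
  have xy : x * y = e.
    have -> : x = z by rewrite -ex -zy -mulrA yx ee.
    exact: zy.
  exists y => //; apply/UP; split=> // l Ul; have /UP[[Vl el] _] := Ul.
  have -> : y * l = y * (l * x) * y by rewrite -!mulrA xy ee.
  by rewrite -(xU l Ul) mulrA yx el.
have [||||L [phi [phi1 phiM phiU]]] := @subfield_type K A U e Ue e_neq0.
- by move=> x /UP[[Vx _] _]; apply: ee.
- move=> x y /UP[[Vx ex] xC] /UP[[Vy ey] yC]; apply/UP; split.
    by split; [apply: VM | rewrite mulrA ex].
  by move=> z Uz; rewrite -mulrA yC // mulrA xC // mulrA.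
- exact: UC.
- exact: Uinv.
have phi_in l : phi l \in U by apply/phiU; exists l.
have phiP l : V (phi l) /\ e * phi l = phi l by have /UP[] := phi_in l.
have [|||n [rho rhoP]] :=
    @dense_representation K A V e L phi V0 VD VM Vmin Ve e_neq0 ee phi1 phiM.
- by move=> l; have [] := phiP l.
- by move=> l; have [] := phiP l.
- move=> d Vd ed dC; apply/phiU/UP; split=> // y /phiU[l <-].
  exact: dC.
by exists L, n, rho.
Qed.

(** * Splittings and the trace over the centre *)

Lemma sum_lift (R : pzRingType) (V : zmodType) (f : R -> V -> V) m
    (i0 : 'I_m.+1) (w : 'I_m -> R) x0 (x : 'I_m.+1 -> V) :
  \sum_i f (if unlift i0 i is Some j then w j else x0) (x i) =
  f x0 (x i0) + \sum_i f (w i) (x (lift i0 i)).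
Proof.
rewrite (bigD1_ord i0) //= unlift_none; congr (_ + _).
by apply: eq_bigr => i _; rewrite liftK.
Qed.

(** The left multiplication by B acts on the n columns separately. *)
Lemma mxtrace_lin_mulmx (R : comNzRingType) n (B : 'M[R]_n) :
  \tr (lin_mulmx B : 'M_(n * n)) = n%:R * \tr B.
Proof.
rewrite /mxtrace (reindex _ (curry_mxvec_bij _ _)) /=.
transitivity (\sum_i \sum_(j < n) B i i); last first.
  by rewrite mulr_sumr; apply: eq_bigr => i _; rewrite sumr_const card_ord mulr_natl.
rewrite pair_bigA; apply: eq_bigr => -[i j] _ /=.
rewrite mxE /= mxvecE vec_mx_delta mxE (bigD1 i) //= mxE !eqxx mulr1.
by rewrite big1 ?addr0 // => k /negbTE ki; rewrite mxE ki mulr0.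
Qed.

(** The centre is represented by a field Z and a morphism phi. *)
Section OverCentre.
Variables (K : fieldType) (A : falgType K).
Hypothesis simpleA : simple_alg A.
Variables (Z : fieldType) (phi : {rmorphism Z -> A}).
Hypothesis phiZ : forall z, z \in centre A <-> exists y, phi y = z.

Let phiC y x : phi y * x = x * phi y.
Proof. by have /phiZ/centreP-> : exists y', phi y' = phi y by exists y. Qed.

Lemma centre_basis : exists m (a : 'I_m -> A), forall x,
  exists! c : {ffun 'I_m -> Z}, x = \sum_i phi (c i) * a i.
Proof.
pose act (z : Z) (x : A) := phi z * x.
have actA x y v : act x (act y v) = act (x * y) v.
  by rewrite /act rmorphM mulrA.
have act1 : left_id 1 act by move=> v; rewrite /act rmorph1 mul1r.
have actDr : right_distributive act +%R by move=> z x y; apply: mulrDr.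
have actDl v : {morph act^~ v : x y / x + y}.
  by move=> x y; rewrite /act rmorphD mulrDl.
have kphi (k : K) : exists z, phi z = k%:A.
  by apply/phiZ/centreP => x; rewrite -scalerAl -scalerAr mul1r mulr1.
have [f fE] := choice kphi.
have gen v : exists c : 'I_(\dim (fullv : {vspace A})) -> Z,
    v = \sum_i act (c i) (vbasis (fullv : {vspace A}))`_i.
  exists (fun i => f (coord (vbasis fullv) i v)).
  rewrite {1}(coord_vbasis (memvf v)); apply: eq_bigr => i _.
  by rewrite /act fE -scalerAl mul1r.
have [m [a h]] := fin_gen_action_basis actA act1 actDr actDl gen.
by exists m, a.
Qed.

Variables (m : nat) (a : 'I_m -> A).
Hypothesis basis_a : forall x,
  exists! c : {ffun 'I_m -> Z}, x = \sum_i phi (c i) * a i.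

Lemma centre_free (c : 'I_m -> Z) : \sum_i phi (c i) * a i = 0 -> forall i, c i = 0.
Proof.
move=> c0 i; have [f [fE fU]] := basis_a 0.
have fc : f = [ffun i => c i].
  by apply: fU; rewrite -[LHS]c0; apply: eq_bigr => j _; rewrite ffunE.
have f0 : f = [ffun=> 0].
  by apply: fU; rewrite big1 // => j _; rewrite ffunE rmorph0 mul0r.
by have := congr1 (fun f : {ffun _ -> _} => f i) (etrans (esym fc) f0); rewrite !ffunE.
Qed.

Lemma dim_over_centre : \dim (fullv : {vspace A}) = (m * \dim (centre A))%N.
Proof.
pose U i := (linfun (amulr (a i)) @: centre A)%VS.
have UP i x : reflect (exists2 z, z \in centre A & x = z * a i) (x \in U i).
  apply: (iffP memv_imgP) => -[z Zz ->]; exists z => //.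
    by rewrite lfunE /= lfunE.
  by rewrite lfunE /= lfunE.
have dxU : directv (\sum_i U i).
  apply/directv_sum_independent => u Uu u0 i _.
  have hz j : exists y, u j = phi y * a j.
    by have /UP[_ /phiZ[y <-] ->] := Uu j isT; exists y.
  have [y yE] := choice hz.
  rewrite yE (centre_free (c := y)) ?rmorph0 ?mul0r //.
  by rewrite -[RHS]u0; apply: eq_bigr => j _; rewrite yE.
have -> : fullv = (\sum_i U i)%VS :> {vspace A}.
  apply/esym/eqP; rewrite eqEsubv subvf; apply/subvP => x _.
  have [c [-> _]] := basis_a x; apply: memv_sumr => i _.
  by apply/UP; exists (phi (c i)) => //; apply/phiZ; exists (c i).
rewrite (directvP dxU) /= -[in RHS](card_ord m) -sum_nat_const.
apply: eq_bigr => i _; apply: limg_dim_eq; apply/eqP; rewrite -subv0.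
apply/subvP => x /memv_capP[/phiZ[y <-]]; rewrite memv_ker memv0 lfunE /= lfunE /=.
move=> /eqP ya; rewrite (_ : y = 0) ?rmorph0 //.
have := centre_free (c := fun j => if j == i then y else 0) _ i.
rewrite eqxx; apply; rewrite (bigD1 i) //= eqxx ya add0r big1 // => j /negbTE ji.
by rewrite ji rmorph0 mul0r.
Qed.

Section Representation.
Variables (L : fieldType) (n : nat) (rho : {rmorphism A -> 'M[L]_n}).
Hypotheses (n_gt0 : (0 < n)%N)
  (rho_centre : forall z, z \in centre A -> is_scalar_mx (rho z)).

Lemma scalar_rmorphism :
  exists sigma : {rmorphism Z -> L}, forall z, rho (phi z) = (sigma z)%:M.
Proof.
pose i0 := Ordinal n_gt0; pose s z := rho (phi z) i0 i0.
have sE z : rho (phi z) = (s z)%:M.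
  have /is_scalar_mxP[l lE] : is_scalar_mx (rho (phi z)).
    by apply/rho_centre/phiZ; exists z.
  by rewrite /s lE mxE eqxx mulr1n.
have s_zmod : zmod_morphism s by move=> x y; rewrite /s !rmorphB !mxE.
have s_mul : monoid_morphism s.
  split=> [|x y]; first by rewrite /s !rmorph1 mxE eqxx.
  by rewrite {1}/s !rmorphM /= !sE -[_ * _]/(_ *m _) -scalar_mxM mxE eqxx.
pose zm := GRing.isZmodMorphism.Build Z L s s_zmod.
pose mm := GRing.isMonoidMorphism.Build Z L s s_mul.
by exists (HB.pack_for {rmorphism Z -> L} s zm mm).
Qed.

Variable sigma : {rmorphism Z -> L}.
Hypothesis sigmaE : forall z, rho (phi z) = (sigma z)%:M.

(** The algebra generated by A and a commuting field L is their tensor product over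
    Z (Artin and Whaples).  If c ord0 is not 0, multiplying the relation by
    elements of A on both sides and adding up makes it 1; the commutators with x
    then satisfy a shorter relation, hence vanish, so that all the coefficients are
    central.  This contradicts the freeness of l over Z. *)
Lemma free_scalars_free r (l : 'I_r -> L) :
  (forall z : 'I_r -> Z, \sum_i sigma (z i) * l i = 0 -> forall i, z i = 0) ->
  forall c : 'I_r -> A, \sum_i l i *: rho (c i) = 0 -> forall i, c i = 0.
Proof.
elim: r l => [l _ c _ []//|r IHr] l lfree.
have IH := IHr (fun i => l (lift ord0 i)).
have {}IH c : \sum_i l i *: rho (c i) = 0 -> c ord0 = 0 -> forall i, c i = 0.
  move=> c0 c00 i; case: (unliftP ord0 i) => [j|] -> //; move: j.
  apply: (IH _ (fun j => c (lift ord0 j))).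
    move=> z z0 i'.
    have := lfree (fun i => if unlift ord0 i is Some j then z j else 0) _
      (lift ord0 i').
    rewrite liftK; apply; rewrite (sum_lift (fun x y => sigma x * y)).
    by rewrite rmorph0 mul0r add0r.
  by rewrite (bigD1_ord ord0) //= c00 rmorph0 scaler0 add0r in c0.
move=> c c0; apply: (IH) => //; apply/eqP/negPn/negP => c00.
have [s s1] := simple_ideal_gen simpleA c00 1.
(* the relation normalised so that its first coefficient is 1 *)
pose c' i := \sum_(p <- s) p.1 * c i * p.2.
have c'0 : \sum_i l i *: rho (c' i) = 0.
  under eq_bigr => i _ do rewrite rmorph_sum scaler_sumr.
  rewrite exchange_big big1 // => p _ /=.
  have e i : l i *: rho (p.1 * c i * p.2) = rho p.1 *m (l i *: rho (c i)) *m rho p.2.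
    by rewrite !rmorphM -scalemxAr -scalemxAl.
  rewrite (eq_bigr _ (fun i _ => e i)) -mulmx_suml -mulmx_sumr c0.
  by rewrite mulmx0 mul0mx.
have c'Z i : exists y, phi y = c' i.
  apply/phiZ/centreP => x; apply/esym/eqP; rewrite -subr_eq0; apply/eqP.
  apply: (IH (fun i => x * c' i - c' i * x)); last by rewrite /c' -s1 mulr1 mul1r subrr.
  under eq_bigr => j _ do rewrite rmorphB !rmorphM scalerBr.
  rewrite sumrB; apply/eqP; rewrite subr_eq0; apply/eqP.
  transitivity (rho x *m \sum_i l i *: rho (c' i)).
    by rewrite mulmx_sumr; apply: eq_bigr => j _; rewrite -scalemxAr.
  rewrite c'0 mulmx0; symmetry.
  transitivity ((\sum_i l i *: rho (c' i)) *m rho x); last by rewrite c'0 mul0mx.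
  by rewrite mulmx_suml; apply: eq_bigr => j _; rewrite -scalemxAl.
have [y yE] := choice c'Z.
have y0 : y ord0 = 0.
  pose i0 := Ordinal n_gt0.
  apply: lfree; have := congr1 (fun M : 'M_n => M i0 i0) c'0.
  rewrite summxE !mxE => h; rewrite -[RHS]h; apply: eq_bigr => i _.
  by rewrite -yE sigmaE !mxE eqxx mulr1n mulrC.
by move/eqP: (yE ord0); rewrite y0 rmorph0 /c' -s1 eq_sym oner_eq0.
Qed.

(** The same fact read from the other side: eliminating an l i that depends on the
    others over Z reduces to the case where l is free. *)
Lemma free_family_free r (l : 'I_r -> L) (c : 'I_r -> A) :
  (forall z : 'I_r -> Z, \sum_i phi (z i) * c i = 0 -> forall i, z i = 0) ->
  \sum_i l i *: rho (c i) = 0 -> forall i, l i = 0.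
Proof.
elim: r l c => [l c _ _ []//|r IHr] l c cfree lc0.
have [lfree|] := pselect (forall z : 'I_r.+1 -> Z,
    \sum_i sigma (z i) * l i = 0 -> forall i, z i = 0).
  have c0 := free_scalars_free lfree lc0.
  have h : 1 = 0 :> Z.
    by apply: (cfree (fun=> 1) _ ord0); rewrite big1 // => i _; rewrite c0 mulr0.
  by move/eqP: h; rewrite oner_eq0.
move=> /existsNP[z /not_implyP[z0 /existsNP[i0 /eqP zi0]]].
(* l i0 is eliminated from the relation between the l i over Z *)
pose w i := z (lift i0 i) / z i0.
have li0 : l i0 = - \sum_i sigma (w i) * l (lift i0 i).
  have si0 : sigma (z i0) != 0 by rewrite fmorph_eq0.
  apply: (mulfI si0); move: z0; rewrite (bigD1_ord i0) //= => /eqP.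
  rewrite addr_eq0 => /eqP->; rewrite mulrN mulr_sumr; congr (- _).
  by apply: eq_bigr => i _; rewrite mulrA -rmorphM /w mulrCA divff // mulr1.
have l0 : forall i, l (lift i0 i) = 0.
  apply: (IHr _ (fun i => c (lift i0 i) - phi (w i) * c i0)).
    move=> y y0 i; have := cfree (fun i => if unlift i0 i is Some j then y j
      else - \sum_i y i * w i) _ (lift i0 i).
    rewrite liftK; apply; rewrite (sum_lift (fun x y => phi x * y)) -[RHS]y0.
    under [RHS]eq_bigr do rewrite mulrBr.
    rewrite sumrB addrC rmorphN mulNr; congr (_ - _).
    rewrite rmorph_sum mulr_suml; apply: eq_bigr => j _.
    by rewrite rmorphM mulrA.
  rewrite -[RHS]lc0 [RHS](bigD1_ord i0) //= li0 scaleNr addrC scaler_suml -sumrB.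
  apply: eq_bigr => i _; rewrite rmorphB rmorphM scalerBr; congr (_ - _).
  rewrite -[_ * _]/(_ *m _) sigmaE mul_scalar_mx scalerA.
  by rewrite mulrC.
move=> i; case: (unliftP i0 i) => [j|] -> //.
by rewrite li0 big1 ?oppr0 // => j _; rewrite l0 mulr0.
Qed.

Hypothesis rho_span : forall B : 'M[L]_n, exists c : A -> L,
  B = \sum_(x <- vbasis (fullv : {vspace A})) c x *: rho x.

(** Its rows are the images of the basis a, flattened into vectors of length n^2. *)
Let P := \matrix_k mxvec (rho (a k)) : 'M[L]_(m, n * n).

Let P_free : row_free P.
Proof.
rewrite -kermx_eq0; apply/eqP/row_matrixP => i; rewrite row0.
set v := row i _; have : v *m P = 0 by apply/sub_kermxP; rewrite row_sub.
rewrite mulmx_sum_row => vP; apply/rowP => k; rewrite [RHS]mxE.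
apply: (free_family_free (l := v 0) (c := a)); first exact: centre_free.
apply: (can_inj mxvecK); rewrite linear0 linear_sum -[RHS]vP.
by apply: eq_bigr => j _; rewrite linearZ rowK.
Qed.

Let P_full : row_full P.
Proof.
rewrite -sub1mx; apply/row_subP => i; set v := row i _.
have [c cE] := rho_span (vec_mx v).
have addP (I : Type) (r : seq I) (F : I -> 'rV[L]_(n * n)) :
    (forall i, (F i <= P)%MS) -> ((\sum_(i <- r) F i)%R <= P)%MS.
  by move=> h; elim/big_ind: _ => // [|x y]; [apply: sub0mx | apply: addmx_sub].
rewrite -[v]vec_mxK cE linear_sum; apply: (addP) => x /=.
rewrite linearZ; apply: scalemx_sub; have [z [-> _]] := basis_a x.
rewrite rmorph_sum linear_sum; apply: (addP) => k /=.
rewrite rmorphM sigmaE -[_ * _]/(_ *m _) mul_scalar_mx linearZ; apply: scalemx_sub.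
have := row_sub k P; rewrite rowK; exact.
Qed.

Lemma dim_central_basis : m = (n * n)%N.
Proof.
by rewrite -(eqP P_free) (eqP P_full).
Qed.

(** The images of a basis of A over Z form a basis of the matrices over L; in it, the
    left multiplication by rho x has the matrix of the left multiplication by x.
    Its trace is n tr(rho x). *)
Lemma trace_over_centre x (M : 'M[Z]_m) :
  (forall k, x * a k = \sum_l phi (M k l) * a l) ->
  sigma (\tr M) = n%:R * \tr (rho x).
Proof.
move=> hM; rewrite -mxtrace_lin_mulmx -trace_map_mx.
have PM : map_mx sigma M *m P = P *m lin_mulmx (rho x).
  apply/row_matrixP => k; rewrite !row_mul rowK mul_rV_lin /= mxvecK.
  have -> : rho x *m rho (a k) = \sum_l sigma (M k l) *: rho (a l).
    transitivity (rho (x * a k)); first by rewrite rmorphM.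
    rewrite hM rmorph_sum; apply: eq_bigr => l _.
    by rewrite rmorphM sigmaE -[_ * _]/(_ *m _) mul_scalar_mx.
  rewrite linear_sum mulmx_sum_row; apply: eq_bigr => l _ /=.
  by rewrite !mxE rowK linearZ.
have PQ : P *m pinvmx P = 1%:M by apply: mulmxVp.
have QP : pinvmx P *m P = 1%:M by apply: mulVpmx.
rewrite -[lin_mulmx _]mul1mx -QP -mulmxA -PM mulmxA mxtrace_mulC mulmxA PQ mul1mx.
by [].
Qed.
End Representation.
End OverCentre.

Lemma simple_splitting (K : fieldType) (A : falgType K) :
  simple_alg A -> exists S : splitting A, True.
Proof.
move=> simpleA.
have [L [n [rho [n_gt0 rho_centre rho_span]]]] := simple_dense_representation simpleA.
have [Z [phi phiZ]] := centre_field simpleA.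
have [m [a basis_a]] := centre_basis phiZ.
have [sigma sigmaE] := scalar_rmorphism phiZ n_gt0 rho_centre.
have dimA := dim_over_centre phiZ basis_a.
rewrite (dim_central_basis simpleA phiZ basis_a n_gt0 sigmaE rho_span) in dimA.
by exists (Splitting rho_centre dimA rho_span).
Qed.

(** * Reduced trace and reduced characteristic polynomial *)

Section NewtonSolution.
Variables (K : fieldType) (A : falgType K) (s : nat -> A).
Hypothesis charK : forall n, (n.+1%:R : K) != 0.

Lemma falg_mulrn_inj n (x : A) : x *+ n.+1 = 0 -> x = 0.
Proof.
by rewrite -scaler_nat => /eqP; rewrite scaler_eq0 (negbTE (charK n)) => /eqP.
Qed.

(** The coefficients of index at most n of the solution of t z' = s z with constant
    term 1. *)
Fixpoint newton_seq n : seq A :=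
  if n is n'.+1 then
    let l := newton_seq n' in
    rcons l (n'.+1%:R^-1 *: \sum_(i < n'.+1) s i.+1 * nth 0 l (n' - i)%N)
  else [:: 1].

Lemma size_newton_seq n : size (newton_seq n) = n.+1.
Proof. by elim: n => //= n IHn; rewrite size_rcons IHn. Qed.

Lemma nth_newton_seq n k : (k <= n)%N ->
  nth 0 (newton_seq n) k = nth 0 (newton_seq k) k.
Proof.
elim: n => [|n IHn]; first by rewrite leqn0 => /eqP->.
rewrite leq_eqVlt => /orP[/eqP->//|]; rewrite ltnS => lekn.
by rewrite /= nth_rcons size_newton_seq ltnS lekn IHn.
Qed.

Definition newton_sol n : A := nth 0 (newton_seq n) n.

Lemma newton_sol_logder : logder s newton_sol.
Proof.
case=> [|n]; first by rewrite mulr0n big_ord0.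
rewrite /newton_sol /= nth_rcons size_newton_seq ltnn eqxx.
rewrite -scaler_nat scalerA divff // scale1r; apply: eq_bigr => i _.
by rewrite subSS nth_newton_seq // leq_subr.
Qed.

Lemma newton_sol_closed (P : A -> Prop) :
  P 1 -> (forall x y, P x -> P y -> P (x + y)) ->
  (forall x y, P x -> P y -> P (x * y)) -> (forall k x, P x -> P (k *: x)) ->
  (forall n, P (s n.+1)) -> forall n, P (newton_sol n).
Proof.
move=> P1 PD PM PZ Ps n.
have P0 : P 0 by rewrite -(scale0r 1); apply: PZ.
have [m] := ubnP n; elim: m n => // m IHm [|n] //; rewrite ltnS => le_nm.
rewrite /newton_sol /= nth_rcons size_newton_seq ltnn eqxx; apply: PZ.
elim/big_ind: _ => // i _; apply: PM => //; rewrite nth_newton_seq ?leq_subr //.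
by apply: IHm; apply: leq_ltn_trans le_nm; rewrite leq_subr.
Qed.

End NewtonSolution.

Section Reduced.
Variables (K : fieldType) (A : falgType K).
Hypothesis charK : forall n, (n.+1%:R : K) != 0.
Hypothesis simpleA : simple_alg A.
Implicit Types (S : splitting A) (a x y z : A).

Lemma sp_deg_gt0 S : (0 < sp_deg S)%N.
Proof.
have := sp_dim S; rewrite dimvf; case: (sp_deg S) => // dA.
by have := FalgType_proper A; rewrite dA.
Qed.

Lemma sp_one_neq0 S : (1 : 'M[sp_field S]_(sp_deg S)) != 0.
Proof.
apply/eqP => /matrixP/(_ (Ordinal (sp_deg_gt0 S)) (Ordinal (sp_deg_gt0 S))).
by rewrite !mxE eqxx; apply/eqP; rewrite oner_eq0.
Qed.

Lemma sp_inj S : injective S.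
Proof. exact: simple_rmorph_inj (sp_one_neq0 S). Qed.

Lemma falg_natr_neq0 n : (n.+1%:R : A) != 0.
Proof.
apply: contraTneq (oner_neq0 A) => n0.
by rewrite negbK; apply/eqP; apply: (falg_mulrn_inj charK n0).
Qed.

Lemma sp_natr_neq0 S n : (n.+1%:R : sp_field S) != 0.
Proof.
apply: contra (falg_natr_neq0 n) => /eqP n0; apply/eqP/(@sp_inj S).
rewrite rmorph_nat rmorph0; apply/matrixP => i j.
rewrite mulmxnE !mxE; case: (i == j); last by rewrite mul0rn.
by rewrite mulr1n n0.
Qed.

Lemma mx_mulrn_inj S n (B : 'M[sp_field S]_(sp_deg S)) : B *+ n.+1 = 0 -> B = 0.
Proof.
move=> B0; apply/matrixP => i j; have /matrixP/(_ i j) := B0.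
rewrite mulmxnE !mxE -mulr_natl => /eqP; rewrite mulf_eq0 (negbTE (sp_natr_neq0 S n)).
by move=> /eqP.
Qed.

(** The trace over the centre of the left multiplication by a, divided by n. *)
Lemma sp_trace_central a :
  exists2 z, z \in centre A & forall S, S z = (\tr (S a))%:M.
Proof.
have [S0 _] := simple_splitting simpleA.
have [Z [phi phiZ]] := centre_field simpleA.
have [m [b basis_b]] := centre_basis phiZ.
have deg2 S : (sp_deg S * sp_deg S)%N = m.
  have [sigma sigmaE] := scalar_rmorphism phiZ (sp_deg_gt0 S) (@sp_centre _ _ S).
  have n_gt0 := sp_deg_gt0 S.
  by rewrite (dim_central_basis simpleA phiZ basis_b n_gt0 sigmaE (@sp_span _ _ S)).
have degE S : sp_deg S = sp_deg S0.
  by apply/eqP; rewrite -eqn_sqr -!mulnn !deg2.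
have hM k : exists c : {ffun 'I_m -> Z}, a * b k = \sum_l phi (c l) * b l.
  by have [c [cE _]] := basis_b (a * b k); exists c.
have [M ME] := choice hM.
pose t := \tr (\matrix_(k, l) M k l).
have [N NE] : exists N, sp_deg S0 = N.+1.
  by exists (sp_deg S0).-1; rewrite prednK // sp_deg_gt0.
exists (phi (t / N.+1%:R)); first by apply/phiZ; exists (t / N.+1%:R).
move=> S; have [sigma sigmaE] := scalar_rmorphism phiZ (sp_deg_gt0 S) (@sp_centre _ _ S).
have := @trace_over_centre _ _ simpleA _ _ phiZ _ _ basis_b _ _ _ (sp_deg_gt0 S) _
  sigmaE (@sp_span _ _ S) a (\matrix_(k, l) M k l).
move=> /(_ _)-tE; rewrite sigmaE rmorphM fmorphV rmorph_nat tE; last first.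
  by move=> k; rewrite ME; apply: eq_bigr => l _; rewrite mxE.
congr (_%:M); have -> : (sp_deg S)%:R = N.+1%:R :> sp_field S by rewrite degE NE.
rewrite mulrAC divff ?mul1r //.
exact: sp_natr_neq0.
Qed.

Lemma trdZP a : trdZ a \in centre A /\ forall S, S (trdZ a) = (\tr (S a))%:M.
Proof.
have [S0 _] := simple_splitting simpleA; have [z Zz zE] := sp_trace_central a.
rewrite /trdZ; case: xgetP => [y _ [Zy [S Sy]]|/(_ z) none]; last first.
  by exfalso; apply: none; split=> //; exists S0.
suff -> : y = z by [].
by apply: (@sp_inj S); rewrite Sy zE.
Qed.

Lemma trdZ_centre a : trdZ a \in centre A. Proof. by have [] := trdZP a. Qed.
Lemma sp_trdZ S a : S (trdZ a) = (\tr (S a))%:M. Proof. by have [_ ->] := trdZP a. Qed.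

Lemma sp_nat S n : S (n%:R) = n%:R%:M.
Proof.
rewrite rmorph_nat; apply/matrixP => i j; rewrite mulmxnE !mxE.
by case: (i == j); rewrite ?mul0rn.
Qed.

(** The coefficients of the reduced inverse characteristic polynomial of a, defined
    inside the centre by Newton's identities from the reduced traces of the powers
    of a. *)
Definition redchar a : nat -> A := newton_sol (fun k => - trdZ (a ^+ k)).

Lemma redchar_logder a : logder (fun k => - trdZ (a ^+ k)) (redchar a).
Proof. exact: newton_sol_logder. Qed.

Lemma redchar0 a : redchar a 0 = 1. Proof. by []. Qed.

Lemma redchar_centre a k : redchar a k \in centre A.
Proof.
apply: (newton_sol_closed (P := fun z => z \in centre A)).
- exact: centre1.
- by move=> x y; apply: memvD.
- exact: centreM.
- by move=> c x; apply: memvZ.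
- by move=> n; rewrite memvN trdZ_centre.
Qed.

(** Both sides, as series of scalar matrices, have logarithmic derivative
    - sum_k tr(S a^k) t^k and constant term 1. *)
Lemma sp_redchar S a k : S (redchar a k) = ((\det (charseries (S a)))`_k)%:M.
Proof.
move: k; apply: (@logder_unique _ (S \o (fun k => - trdZ (a ^+ k)))).
- exact: mx_mulrn_inj.
- apply: (logder_morph (phi := S)); [exact: rmorphD | exact: rmorphM |].
  exact: redchar_logder.
- have h := @logder_morph _ _ (fun l : sp_field S => l%:M : 'M_(sp_deg S)) _ _ _ _
    (det_charseries_logder (S a)).
  apply: eq_logder (h _ _) => //.
  + move=> k; transitivity (- S (trdZ (a ^+ k.+1))); last by rewrite /= rmorphN.
    by rewrite sp_trdZ rmorphXn /= raddfN.
  + by move=> x y; rewrite raddfD.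
  + by move=> x y; rewrite scalar_mxM.
- by rewrite redchar0 rmorph1 det_charseries0.
Qed.

Lemma sp_polyE S a : sp_poly S (1 - a%:P * 'X) = charseries (S a).
Proof.
apply/matrixP => i j; apply/polyP => k; rewrite mxE charseries_coef.
rewrite coef_poly; have -> : (if (k < size (1 - a%:P * 'X)%R)%N then
    S (1 - a%:P * 'X)`_k i j else 0) = S (1 - a%:P * 'X)`_k i j.
  by case: ltnP => // le; rewrite nth_default // rmorph0 mxE.
rewrite coefB coefMX coef1 coefC; case: k => [|[|k]] /=.
- by rewrite subr0 rmorph1.
- by rewrite sub0r rmorphN.
- by rewrite subr0 rmorph0.
Qed.

Lemma nrdZ_polyE a k : (nrdZ_poly (1 - a%:P * 'X))`_k = redchar a k.
Proof.
have [S0 _] := simple_splitting simpleA.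
rewrite /nrdZ_poly; case: xgetP => [p _ [_ [S Sp]]|].
  by apply: (@sp_inj S); rewrite Sp sp_redchar sp_polyE.
move=> /(_ (\poly_(k < size (\det (charseries (S0 a)))) redchar a k)) none; exfalso.
have cE i : (\poly_(k < size (\det (charseries (S0 a)))) redchar a k)`_i = redchar a i.
  rewrite coef_poly; case: ltnP => // le; apply: (@sp_inj S0).
  by rewrite rmorph0 sp_redchar nth_default // raddf0.
apply: none; split; first by move=> i; rewrite cE redchar_centre.
by exists S0 => i; rewrite cE sp_redchar sp_polyE.
Qed.

End Reduced.

(** * The substitution of 1/t for t *)

Section Inversion.
Variable K : fieldType.
Implicit Type p : {poly K}.
Local Notation x := (ratfun_t K).

Definition ratfun_const_rmorph : {rmorphism K -> {ratfun K}} :=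
  @FracField.tofrac _ \o @polyC K.

Definition poly_tinv_rmorph : {rmorphism {poly K} -> {ratfun K}} :=
  horner_eval x^-1 \o map_poly ratfun_const_rmorph.

Lemma poly_tinvE : @poly_tinv K =1 poly_tinv_rmorph. Proof. by []. Qed.

Lemma ratfun_t_neq0 : x != 0.
Proof. by rewrite tofrac_eq0 polyX_eq0. Qed.

(** The polynomial t^N p(1/t), for p of degree at most N. *)
Definition poly_rev N p : {poly K} := \poly_(k < N.+1) p`_(N - k).

Lemma poly_tinv_rev N p : (size p <= N.+1)%N ->
  x ^+ N * poly_tinv p = (poly_rev N p)%:RF.
Proof.
move=> sp; rewrite /poly_tinv.
have -> : map_poly (@ratfun_const K) p = \poly_(k < N.+1) ratfun_const p`_k.
  apply/polyP=> k; rewrite coef_poly (coef_map ratfun_const_rmorph) /=.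
  case: ltnP => // le; rewrite nth_default ?(leq_trans sp) //.
rewrite horner_poly mulr_sumr /poly_rev poly_def rmorph_sum.
rewrite (reindex_inj rev_ord_inj) /=; apply: eq_bigr => k _.
rewrite subSS -mul_polyC rmorphM rmorphXn /= mulrCA; congr (_ * _).
have leK : (k <= N)%N by rewrite -ltnS.
rewrite exprVn; apply/eqP; rewrite -/x.
have xn : x ^+ (N - k) != 0 by rewrite expf_neq0 // ratfun_t_neq0.
by rewrite -(inj_eq (mulIf xn)) mulfVK // -exprD subnKC.
Qed.

(** Since t^n det(1 - B/t) = det(t - B), this determinant is the reversed
    characteristic polynomial. *)
Lemma coef_det_charseries n (B : 'M[K]_n) k :
  (\det (charseries B))`_k = if (k <= n)%N then (char_poly B)`_(n - k) else 0.
Proof.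
set c := \det _.
(* N bounds the degree of c beforehand; the identity then shows that n does *)
have [N sN nN] : exists2 N, (size c <= N)%N & (n <= N)%N.
  by exists (maxn (size c) n); [apply: leq_maxl | apply: leq_maxr].
have entry i j : x * poly_tinv_rmorph (charseries B i j) = (char_poly_mx B i j)%:RF.
  have s2 : (size (charseries B i j) <= 2)%N.
    by apply/leq_sizeP => -[|[|l]] // _; rewrite charseries_coef mxE.
  rewrite -poly_tinvE -[x]expr1 poly_tinv_rev //; congr (_%:RF).
  apply/polyP => l; rewrite coef_poly charseries_coef /char_poly_mx.
  rewrite [in RHS]mxE [in RHS]mxE [in RHS]mxE [in RHS]mxE.
  rewrite coefB coefMn coefX coefC.
  by case: l => [|[|l]] /=; rewrite ?mxE /= ?mul0rn ?sub0r ?subr0 ?oppr0.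
have xc : x ^+ n * poly_tinv c = (char_poly B)%:RF.
  rewrite poly_tinvE -!det_map_mx -detZ; congr (\det _).
  by apply/matrixP => i j; rewrite [LHS]mxE [X in _ * X]mxE [RHS]mxE entry.
have cE : poly_rev N c = 'X^(N - n) * char_poly B.
  apply/eqP; rewrite -tofrac_eq; apply/eqP.
  rewrite -poly_tinv_rev ?leqW // rmorphM rmorphXn /= -xc mulrA -exprD subnK //.
have [leN|ltN] := leqP k N; last first.
  rewrite (leqNgt k n) (leq_ltn_trans nN ltN) /= nth_default //.
  exact: leq_trans sN (ltnW ltN).
have := congr1 (fun p : {poly K} => p`_(N - k)) cE.
rewrite coef_poly ltnS leq_subr subKn // => ->; rewrite coefXnM.
have [le|lt] := leqP k n.
  rewrite ltnNge leq_sub2l //=; congr (_`_ _).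
  by rewrite -subnDA addnC subnDA subKn.
by rewrite ltn_sub2l // (leq_trans lt).
Qed.

End Inversion.

(** * Reduced trace and norm over the base field *)

Section Centre.
Variables (K : fieldType) (A : falgType K).
Implicit Types (a x y z : A).
Local Notation b := (vbasis (centre A)).

Lemma centre_mx_linear : linear (@centre_mx K A).
Proof.
move=> k x y; apply/matrixP => i j.
by rewrite !mxE mulrDl -scalerAl linearP.
Qed.

HB.instance Definition _ :=
  GRing.isLinear.Build K A 'M[K]_(\dim (centre A)) _ (@centre_mx K A) centre_mx_linear.

Lemma centre_mx1 : centre_mx (1 : A) = 1%:M.
Proof.
apply/matrixP => i j; rewrite !mxE mul1r coord_free //.
exact: basis_free (vbasisP _).
Qed.

Lemma centre_mxM x y : x \in centre A -> y \in centre A ->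
  centre_mx (x * y) = centre_mx x *m centre_mx y.
Proof.
move=> Zx Zy; have -> : x * y = y * x by have /centreP := Zx; apply.
have bZ i : b`_(i : 'I_(\dim (centre A))) \in centre A.
  by rewrite vbasis_mem ?mem_nth ?size_tuple.
apply/matrixP => i j; rewrite !mxE -mulrA.
rewrite (coord_vbasis (centreM Zx (bZ i))) mulr_sumr linear_sum.
by apply: eq_bigr => k _; rewrite -scalerAr linearZ !mxE.
Qed.

Lemma dim_centre_gt0 : (0 < \dim (centre A))%N.
Proof.
rewrite lt0n dimv_eq0; apply: contraTneq (centre1 A) => ->.
by rewrite memv0 oner_eq0.
Qed.

End Centre.

Section ReducedTraceNorm.
Variables (K : fieldType) (A : falgType K).
Hypothesis charK : forall n, (n.+1%:R : K) != 0.
Hypothesis simpleA : simple_alg A.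
Implicit Types (S : splitting A) (a b x y z : A).

Lemma trdZD a b : trdZ (a + b) = trdZ a + trdZ b.
Proof.
have [S _] := simple_splitting simpleA.
by apply: (sp_inj simpleA (S := S)); rewrite rmorphD !sp_trdZ // rmorphD !raddfD.
Qed.

Lemma trdZ_scale k a : trdZ (k *: a) = k *: trdZ a.
Proof.
have [S _] := simple_splitting simpleA.
have Zk : k%:A \in centre A by rewrite memvZ // centre1.
have /is_scalar_mxP[l lE] := sp_centre S Zk.
apply: (sp_inj simpleA (S := S)).
have kE y : k *: y = k%:A * y by rewrite -scalerAl mul1r.
rewrite (kE a) (kE (trdZ a)) rmorphM !sp_trdZ // rmorphM lE.
rewrite -[_%:M * S a]/(_ *m _) -[_%:M * _%:M]/(_ *m _) !mul_scalar_mx mxtraceZ.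
by rewrite scale_scalar_mx.
Qed.

Lemma trdZC a b : trdZ (a * b) = trdZ (b * a).
Proof.
have [S _] := simple_splitting simpleA.
apply: (sp_inj simpleA (S := S)); rewrite !sp_trdZ // !rmorphM.
by rewrite -[S a * _]/(_ *m _) mxtrace_mulC.
Qed.

Lemma Trd_linear : linear (@Trd K A : A -> K^o).
Proof.
move=> k a b; rewrite /Trd trdZD trdZ_scale linearP mxtraceD mxtraceZ.
by [].
Qed.


Lemma TrdD a b : Trd (a + b) = Trd a + Trd b.
Proof. by have := Trd_linear 1 a b; rewrite !scale1r. Qed.

Lemma Trd0 : Trd (0 : A) = 0.
Proof. by apply: (addIr (Trd (0 : A))); rewrite -TrdD !add0r. Qed.

Lemma Trd_scale k a : Trd (k *: a) = k * Trd a.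
Proof. by have := Trd_linear k a 0; rewrite Trd0 !addr0. Qed.

Lemma TrdC a b : Trd (a * b) = Trd (b * a).
Proof. by rewrite /Trd trdZC. Qed.

(** The degree of the reduced norm. *)
Lemma Trd1 S : Trd (1 : A) = (sp_deg S * \dim (centre A))%:R.
Proof.
have -> : Trd (1 : A) = \tr (centre_mx ((sp_deg S)%:R : A)).
  rewrite /Trd; congr (\tr (centre_mx _)); apply: (sp_inj simpleA (S := S)).
  by rewrite sp_trdZ // sp_nat rmorph1 mxtrace1.
by rewrite raddfMn /= centre_mx1 raddfMn /= mxtrace1 natrM mulr_natl.
Qed.

Lemma Trd1_neq0 : Trd (1 : A) != 0.
Proof.
have [S _] := simple_splitting simpleA; rewrite (Trd1 S).
by rewrite -(prednK (n := (_ * _)%N)) // muln_gt0 sp_deg_gt0 dim_centre_gt0.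
Qed.

(** The radical of the trace form is a two-sided ideal, and it does not contain 1. *)
Lemma Trd_nondegenerate a : (forall b, Trd (a * b) = 0) -> a = 0.
Proof.
move=> a0; apply/eqP/negPn/negP => na.
suff /(_ 1 1) : forall x b, Trd (x * b) = 0.
  by rewrite mulr1; apply/eqP/Trd1_neq0.
apply: (simple_ideal_full simpleA (P := fun x => forall b, Trd (x * b) = 0) (a := a)) => //.
- by move=> b; rewrite mul0r Trd0.
- by move=> x y x0 y0 b; rewrite mulrDl TrdD x0 y0 addr0.
- by move=> c x x0 b; rewrite -mulrA TrdC -mulrA x0.
- by move=> c x x0 b; rewrite -mulrA x0.
Qed.

Lemma Trd_sum (I : Type) (r : seq I) (F : I -> A) :
  Trd (\sum_(i <- r) F i) = \sum_(i <- r) Trd (F i).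
Proof. exact: (big_morph _ TrdD Trd0). Qed.

(** The Gram matrix of the trace form is invertible. *)
Lemma Trd_represent (f : A -> K) : linear (f : A -> K^o) ->
  exists u, forall b, f b = Trd (u * b).
Proof.
move=> f_lin.
have fD x y : f (x + y) = f x + f y by have := f_lin 1 x y; rewrite !scale1r.
have f0 : f 0 = 0 by apply: (addIr (f 0)); rewrite -fD !add0r.
have fZ k x : f (k *: x) = k * f x by have := f_lin k x 0; rewrite f0 !addr0.
pose X := vbasis (fullv : {vspace A}); pose n := \dim (fullv : {vspace A}).
pose G := \matrix_(i < n, j < n) Trd (X`_i * X`_j).
have freeX : free X by apply: basis_free (vbasisP _).
have Gu : G \in unitmx.
  suff key (v : 'rV_n) : v *m G = 0 -> v = 0.
    rewrite -row_free_unit -kermx_eq0; apply/eqP/row_matrixP => i; rewrite row0.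
    by apply: key; apply/sub_kermxP; rewrite row_sub.
  move=> vG.
  (* a row killed by G is the coordinate vector of an element of the radical *)
  pose y := \sum_(j < n) v 0 j *: X`_j.
  have y0 : y = 0.
    apply: Trd_nondegenerate => b.
    have yX j : Trd (y * X`_(j : 'I_n)) = 0.
      have /rowP/(_ j) := vG; rewrite !mxE => h; rewrite -[RHS]h.
      rewrite mulr_suml Trd_sum; apply: eq_bigr => k _.
      by rewrite -scalerAl Trd_scale mxE.
    rewrite (coord_vbasis (memvf b)) mulr_sumr Trd_sum big1 // => j _.
    by rewrite -scalerAr Trd_scale yX mulr0.
  apply/rowP => j; rewrite [RHS]mxE.
  by have /freeP h := freeX; apply: (h (v 0)) y0 j.
have [w wG] : exists w : 'rV_n, w *m G = \row_j f X`_j.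
  by exists ((\row_j f X`_j) *m invmx G); rewrite mulmxKV.
exists (\sum_(i < n) w 0 i *: X`_i) => b.
rewrite (coord_vbasis (memvf b)) mulr_sumr Trd_sum.
rewrite (big_morph _ fD f0); apply: eq_bigr => j _.
rewrite fZ -scalerAr Trd_scale; congr (_ * _).
have /rowP/(_ j) := wG; rewrite !mxE => <-.
rewrite mulr_suml Trd_sum; apply: eq_bigr => i _.
by rewrite -scalerAl Trd_scale mxE.
Qed.

Lemma centre_mx_poly_coef a i j k :
  (centre_mx_poly (nrdZ_poly (1 - a%:P * 'X)) i j)`_k = centre_mx (redchar a k) i j.
Proof.
rewrite mxE coef_poly -nrdZ_polyE //; case: ltnP => // le.
by rewrite nth_default // linear0 mxE.
Qed.

(** The multiplication by a central element is a morphism to matrices over K, so that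
    the equation of [redchar] becomes an equation between matrices, to which
    Jacobi's formula applies. *)
Lemma Nrd_poly_logder a :
  logder (fun k => - Trd (a ^+ k)) (nth 0 (Nrd_poly (1 - a%:P * 'X))).
Proof.
have T : logder (fun k => centre_mx (- trdZ (a ^+ k))) (fun k => centre_mx (redchar a k)).
  move=> n; rewrite -raddfMn (redchar_logder charK) raddf_sum; apply: eq_bigr => i _.
  by rewrite /= centre_mxM ?memvN ?trdZ_centre ?redchar_centre.
apply: eq_logder (det_logder (centre_mx_poly_coef a) T) => // k.
by rewrite /Trd linearN raddfN.
Qed.

Lemma Nrd_poly_coef0 a : (Nrd_poly (1 - a%:P * 'X))`_0 = 1.
Proof.
rewrite -horner_coef0 -[LHS]/(horner_eval 0 _) -det_map_mx.
rewrite [X in \det X](_ : _ = 1%:M) ?det1 //.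
apply/matrixP=> i j; rewrite mxE [LHS]horner_coef0.
by rewrite centre_mx_poly_coef redchar0 centre_mx1.
Qed.

Lemma sp_degE S S' : sp_deg S = sp_deg S'.
Proof.
have := sp_dim S; rewrite (sp_dim S') => /eqP.
by rewrite eqn_pmul2r ?dim_centre_gt0 // eqn_sqr => /eqP.
Qed.

Lemma mul_sign_scalar (L : fieldType) n m (l : L) :
  (-1) ^+ n * l%:M = ((-1) ^+ n * l)%:M :> 'M_m.
Proof.
rewrite -signr_odd -[in RHS]signr_odd; case: odd => /=; last by rewrite !expr0 !mul1r.
by rewrite !expr1 !mulN1r; apply/matrixP => i j; rewrite !mxE mulNrn.
Qed.

(** The reduced norm is, up to sign, the leading coefficient of the inverse
    characteristic polynomial. *)
Lemma nrdZE S a : nrdZ a = (-1) ^+ sp_deg S * redchar a (sp_deg S).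
Proof.
have nE S' : S' ((-1) ^+ sp_deg S * redchar a (sp_deg S)) = (\det (S' a))%:M.
  rewrite rmorphMsign sp_redchar // (sp_degE S S') coef_det_charseries leqnn subnn.
  by rewrite char_poly_det mul_sign_scalar signrMK.
rewrite /nrdZ; case: xgetP => [y _ [_ [S' Sy]]|none].
  by apply: (sp_inj simpleA (S := S')); rewrite Sy nE.
exfalso; apply: (none ((-1) ^+ sp_deg S * redchar a (sp_deg S))).
split; last by exists S.
rewrite -signr_odd; case: odd; rewrite ?expr1 ?expr0 ?mulN1r ?mul1r ?memvN;
  exact: redchar_centre.
Qed.

(** From t - B = (- B) (1 - t B^-1). *)
Lemma det_charseries_inverse (L : fieldType) n (B B' : 'M[L]_n) k :
  B *m B' = 1%:M -> (k <= n)%N ->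
  (\det (charseries B))`_(n - k) =
    (-1) ^+ n * \det B * (\det (charseries B'))`_k.
Proof.
move=> BB' lekn; rewrite coef_det_charseries leq_subr subKn //.
have -> : char_poly B = ((-1) ^+ n * \det B)%:P * \det (charseries B').
  have -> : (-1) ^+ n * \det B = \det (- B) by rewrite -scaleN1r detZ.
  rewrite /char_poly -[(\det (- B))%:P]/(polyC _) -det_map_mx -det_mulmx; congr (\det _).
  rewrite /char_poly_mx /charseries mulmxBr mulmx1 mulmxA -map_mxM.
  by rewrite mulNmx BB' map_mxN map_mxN map_mx1 mulNmx mul1mx opprK addrC.
by rewrite coefCM.
Qed.

Lemma redchar_inverse S a b k : a * b = 1 -> (k <= sp_deg S)%N ->
  redchar a (sp_deg S - k) = (-1) ^+ sp_deg S * nrdZ a * redchar b k.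
Proof.
move=> ab lek; apply: (sp_inj simpleA (S := S)).
have SaSb : S a *m S b = 1%:M by rewrite -[_ *m _]/(_ * _) -rmorphM ab rmorph1.
rewrite (nrdZE S) signrMK rmorphM !sp_redchar //.
rewrite -[_%:M * _%:M]/(_ *m _) -scalar_mxM.
rewrite (det_charseries_inverse SaSb lek); congr (_ * _)%:M.
by rewrite coef_det_charseries leqnn subnn char_poly_det.
Qed.

Lemma redchar_eq0 S a k : (sp_deg S < k)%N -> redchar a k = 0.
Proof.
move=> ltk; apply: (sp_inj simpleA (S := S)).
by rewrite sp_redchar // coef_det_charseries leqNgt ltk rmorph0 raddf0.
Qed.

Lemma nrdZ_centre a : nrdZ a \in centre A.
Proof.
have [S _] := simple_splitting simpleA; rewrite (nrdZE S) -signr_odd.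
by case: odd; rewrite ?expr1 ?expr0 ?mulN1r ?mul1r ?memvN redchar_centre.
Qed.

(** The reversal of coefficients of [redchar_inverse] is an identity between the
    matrices of multiplication by central elements; its determinant is the
    functional equation of a single factor. *)
Lemma Nrd_poly_inverse S a b : a * b = 1 ->
  (Nrd_poly (1 - a%:P * 'X))%:RF =
  (- ratfun_t K) ^+ (sp_deg S * \dim (centre A)) * ratfun_const (Nrd a) *
    poly_tinv (Nrd_poly (1 - b%:P * 'X)).
Proof.
move=> ab; set n := sp_deg S; set d := \dim _.
pose P (c : A) := centre_mx_poly (nrdZ_poly (1 - c%:P * 'X)).
(* the constant factor in the reversal of the coefficients *)
pose nu := (-1) ^+ n * nrdZ a.
have Znu : nu \in centre A.
  rewrite /nu -signr_odd; case: odd; rewrite ?expr1 ?expr0 ?mulN1r ?mul1r ?memvN;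
    exact: nrdZ_centre.
have Prev : P a = map_mx polyC (centre_mx nu) *m map_mx (poly_rev n) (P b).
  apply/matrixP => i j; apply/polyP => k; rewrite centre_mx_poly_coef [in RHS]mxE coef_sum.
  under eq_bigr => l _ do rewrite [X in X * _]mxE [X in _ * X]mxE coefCM coef_poly.
  case: ltnP => [|lt]; last first.
    rewrite (redchar_eq0 _ lt) linear0 mxE big1 // => l _.
    by rewrite mulr0.
  rewrite ltnS => lek.
  under eq_bigr => l _ do rewrite centre_mx_poly_coef.
  rewrite -{1}(subKn lek) (redchar_inverse ab) ?leq_subr // centre_mxM ?redchar_centre //.
  by rewrite mxE.
have szP i j : (size (P b i j) <= n.+1)%N.
  apply/leq_sizeP => k ltk; rewrite centre_mx_poly_coef (redchar_eq0 _ ltk).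
  by rewrite linear0 mxE.
rewrite /Nrd_poly -/(P a) -/(P b) Prev det_mulmx rmorphM /=.
have -> : (\det (map_mx (poly_rev n) (P b)))%:RF =
    ratfun_t K ^+ (n * d) * poly_tinv (\det (P b)).
  rewrite poly_tinvE -!det_map_mx exprM -detZ.
  congr (\det _); apply/matrixP => i j.
  have entry : map_mx (poly_rev n) (P b) i j = poly_rev n (P b i j) by rewrite mxE.
  rewrite [LHS]mxE entry [RHS]mxE [X in _ * X]mxE.
  by rewrite -poly_tinvE (poly_tinv_rev (szP i j)).
rewrite det_map_mx -/(ratfun_const _) mulrA; congr (_ * _).
have -> : \det (centre_mx nu) = (-1) ^+ (n * d) * Nrd a.
  have -> : centre_mx nu = (-1) ^+ n *: centre_mx (nrdZ a).
    rewrite /nu -signr_odd -[in RHS]signr_odd.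
    by case: odd; rewrite ?expr1 ?expr0 ?mulN1r ?mul1r ?linearN ?scaleN1r ?scale1r.
  by rewrite detZ -exprM.
rewrite [(- ratfun_t K) ^+ _]exprNn /ratfun_const polyCM tofracM polyC_exp polyCN.
rewrite tofracXn tofracN polyC1 tofrac1.
by rewrite mulrAC.
Qed.

End ReducedTraceNorm.

(** * Decomposition of a semi-simple algebra *)

Section Decomposition.
Variables (K : fieldType) (A : falgType K).
Hypothesis ssA : semisimple_ring A.

(** Two-sided ideals contained in A e, for a central idempotent e. *)
Definition ideal_in (e : A) (P : set A) : Prop :=
  [/\ left_ideal P, forall a x, P x -> P (x * a) & forall x, P x -> x * e = x].

(** The central idempotents e for which A e is a simple algebra. *)
Record simple_idempotent (e : A) : Prop := SimpleIdempotent {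
  si_neq0 : e != 0;
  si_idem : e * e = e;
  si_central : forall x, e * x = x * e;
  si_simple : forall P x, ideal_in e P -> P x -> x != 0 -> P e }.

Let corner (e : A) : {vspace A} := (linfun (amulr e) @: fullv)%VS.

Let cornerP e x : e * e = e -> x \in corner e <-> x * e = x.
Proof.
move=> ee; split=> [/memv_imgP[y _ ->]|xe].
  by rewrite lfunE /= lfunE /= -mulrA ee.
by apply/memv_imgP; exists x; rewrite ?memvf // lfunE /= lfunE.
Qed.

Let corner_lt u e : u * u = u -> e * e = e -> u * e = u -> e * u != e ->
  (\dim (corner u) < \dim (corner e))%N.
Proof.
move=> uu ee ue eu; rewrite ltnNge; apply: contra eu => le.
have sub : (corner u <= corner e)%VS.
  by apply/subvP => x /(cornerP _ uu) <-; apply/(cornerP _ ee); rewrite -mulrA ue.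
have /eqP E : corner u == corner e by rewrite eqEdim sub.
by apply/eqP/(cornerP _ uu); rewrite E; apply/(cornerP _ ee).
Qed.

(** If A e is not simple, the idempotent u generating a proper nonzero ideal splits e
    as u + (e - u); both corners have smaller dimension. *)
Lemma central_idempotent_decomposition e : e * e = e -> (forall x, e * x = x * e) ->
  exists s : seq A, [/\ forall a, a \in s -> simple_idempotent a /\ a * e = a,
    pairwise (fun a b => a * b == 0) s & \sum_(a <- s) a = e].
Proof.
have [n] := ubnP (\dim (corner e)); elim: n e => // n IHn e le_n ee eC.
have [->|e0] := eqVneq e 0; first by exists [::]; rewrite big_nil.
have [simp|] := pselect (forall P x, ideal_in e P -> P x -> x != 0 -> P e).
  by exists [:: e]; rewrite big_seq1; split=> // a; rewrite inE => /eqP->.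
move=> /existsNP[P /existsNP[x /not_implyP[[lP rP eP]]]].
move=> /not_implyP[Px /not_implyP[x0 nPe]].
have [u [Pu uP uC]] := semisimple_two_sided ssA lP rP.
have uu : u * u = u by have [] := uP _ Pu.
have ue : u * e = u by apply: eP.
have eu : e * u = u by rewrite eC.
have u0 : u != 0 by apply: contraNneq x0 => u0; have [<- _] := uP _ Px; rewrite u0 mul0r.
pose v := e - u.
have vv : v * v = v by rewrite /v mulrBl !mulrBr ee eu ue uu subrr subr0.
have ve : v * e = v by rewrite /v mulrBl ee ue.
have vu : v * u = 0 by rewrite /v mulrBl eu uu subrr.
have vC y : v * y = y * v by rewrite /v mulrBl mulrBr eC uC.
have [|s1 [s1P s1o s1s]] := IHn u _ uu uC.
  rewrite -ltnS; apply: leq_trans le_n; rewrite ltnS; apply: corner_lt => //.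
  by rewrite eu; apply: contra_notN nPe => /eqP <-.
have [|s2 [s2P s2o s2s]] := IHn v _ vv vC.
  rewrite -ltnS; apply: leq_trans le_n; rewrite ltnS; apply: corner_lt => //.
  rewrite -vC ve /v; apply: contra u0 => /eqP h.
  by rewrite -[u](subKr e) h subrr.
exists (s1 ++ s2); split.
- move=> a; rewrite mem_cat => /orP[/s1P|/s2P] [sa ae]; split=> //; rewrite -ae -mulrA.
    by rewrite ue.
  by rewrite ve.
- rewrite pairwise_cat s1o s2o !andbT; apply/allrelP => a b /s1P[_ au] /s2P[_ bv].
  by rewrite -au -bv -mulrA [u * _]mulrA uC -[b * u * v]mulrA -vC vu !mulr0.
- by rewrite big_cat /= s1s s2s /v addrC subrK.
Qed.


(** The factors are the corners A e_i, with identity e_i, and the projections the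
    multiplications by e_i. *)
Lemma simple_decomposition : exists (n : nat) (B : 'I_n -> falgType K)
    (pr : forall i, {rmorphism A -> B i}),
  [/\ forall i, simple_alg (B i), forall i k f, pr i (k *: f) = k *: pr i f
    & forall y : (forall i, B i), exists! f, forall i, pr i f = y i].
Proof.
have [s [sP so s1]] := central_idempotent_decomposition (mulr1 1)
  (fun x => etrans (mul1r x) (esym (mulr1 x))).
pose e (i : 'I_(size s)) := s`_i.
have eP i : simple_idempotent (e i) by have [] := sP _ (mem_nth 0 (ltn_ord i)).
have ee i : e i * e i = e i := si_idem (eP i).
have eC i x : e i * x = x * e i := si_central (eP i) x.
have eo i j : i != j -> e i * e j = 0.
  wlog lt : i j / (i < j)%N => [h ne|_].
    have [lt|lt|/val_inj E] := ltngtP i j; first exact: h.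
      by rewrite eC; apply: h => //; rewrite eq_sym.
    by rewrite E eqxx in ne.
  apply/eqP; have /(pairwiseP 0)/(_ i j) := so; apply; rewrite ?inE ?ltn_ord //.
have esum : \sum_i e i = 1 by rewrite -s1 (big_nth 0) big_mkord.
have aB i : is_aspace (corner (e i)).
  apply/andP; split.
    apply/has_algidP; exists (e i); split; first by apply/cornerP.
      exact: si_neq0 (eP i).
    by move=> u /(cornerP _ (ee i)) ue; rewrite eC ue.
  by apply/prodvP => u v _ /(cornerP _ (ee i)) ve; apply/cornerP => //; rewrite -mulrA ve.
pose C i : {aspace A} := ASpace (aB i).
have CP i x : x \in C i <-> x * e i = x by apply: cornerP.
have Ce i : e i \in C i by apply/CP.
have algidE i : algid (C i) = e i.
  by rewrite -[LHS](proj1 (CP i _) (memv_algid (C i))) algidl.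
pose B i : falgType K := subvs_of (C i).
pose p i (f : A) : B i := vsproj (C i) (f * e i).
have pE i f : vsval (p i f : subvs_of (C i)) = f * e i.
  by rewrite vsprojK //; apply/CP; rewrite -mulrA ee.
have p_zmod i : zmod_morphism (p i).
  by move=> x y; apply: val_inj; rewrite /= !pE mulrBl.
have p_mul i : monoid_morphism (p i).
  split=> [|x y]; apply: val_inj; rewrite /= !pE; first by rewrite mul1r algidE.
  by rewrite [x * e i * _]mulrA -[x * e i * y]mulrA eC -!mulrA ee.
pose pr i : {rmorphism A -> B i} :=
  HB.pack (p i) (GRing.isZmodMorphism.Build A (B i) (p i) (p_zmod i))
    (GRing.isMonoidMorphism.Build A (B i) (p i) (p_mul i)).
exists (size s), B, pr; split.
- move=> i U Ul Ur.
  pose P x := exists2 u : B i, u \in U & vsval (u : subvs_of (C i)) = x.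
  have [->|U0] := eqVneq U 0%VS; [by left | right].
  have iP : ideal_in (e i) P.
    split; first split.
    + by exists 0; rewrite ?mem0v.
    + by move=> _ _ [x Ux <-] [y Uy <-]; exists (x + y); rewrite ?memvD.
    + move=> c _ [x Ux <-]; exists (p i c * x).
        by apply: (subvP Ul); rewrite memv_mul ?memvf.
      rewrite /= pE -mulrA eC; congr (_ * _); apply/CP/subvsP.
    + move=> c _ [x Ux <-]; exists (x * p i c).
        by apply: (subvP Ur); rewrite memv_mul ?memvf.
      by rewrite /= pE -eC mulrA (proj1 (CP i _) (subvsP x)).
    + by move=> _ [x Ux <-]; apply/CP/subvsP.
  have [||u Uu ue] := @si_simple _ (eP i) P (vsval (vpick U : subvs_of (C i))) iP.
  + by exists (vpick U); rewrite ?memv_pick.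
  + by rewrite -[X in _ != X](linear0 (@vsval _ _ (C i))) (inj_eq val_inj) vpick0.
  have U1 : (1 : B i) \in U.
    by rewrite (_ : 1 = u) //; apply: val_inj; rewrite /= ue algidE.
  apply/eqP; rewrite eqEsubv subvf; apply/subvP => x _.
  by rewrite -[x]mulr1; apply: (subvP Ul); rewrite memv_mul ?memvf.
- by move=> i k f; apply: val_inj; rewrite /= !pE -scalerAl.
- move=> y; pose f := \sum_i vsval (y i : subvs_of (C i)).
  have ye i : vsval (y i : subvs_of (C i)) * e i = vsval (y i : subvs_of (C i)).
    by apply/CP/subvsP.
  exists f; split.
    move=> i; apply: val_inj; rewrite /= pE mulr_suml (bigD1 i) //= ye big1 ?addr0 //.
    by move=> j ji; rewrite -ye -mulrA eo ?mulr0.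
  move=> g gy; rewrite -[g]mulr1 -esum mulr_sumr; apply: eq_bigr => i _.
  by rewrite -pE -gy.
Qed.

End Decomposition.

(** * Endomorphism algebras in a semi-simple rigid category *)

Local Notation hom := Defs.hom.

Section LinCat.
Variables (K : fieldType) (C : linCat K).
Implicit Types X Y Z : C.

Lemma compDl X Y Z (g g' : hom Y Z) (f : hom X Y) :
  (g + g') \oc f = g \oc f + g' \oc f.
Proof. by have := comp_linl f 1 g g'; rewrite !scale1r. Qed.

Lemma compDr X Y Z (g : hom Y Z) (f f' : hom X Y) :
  g \oc (f + f') = g \oc f + g \oc f'.
Proof. by have := comp_linr g 1 f f'; rewrite !scale1r. Qed.

Lemma comp0l X Y Z (f : hom X Y) : (0 : hom Y Z) \oc f = 0.
Proof. by apply: (addIr (0 \oc f)); rewrite -compDl !add0r. Qed.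

Lemma comp0r X Y Z (g : hom Y Z) : g \oc (0 : hom X Y) = 0.
Proof. by apply: (addIr (g \oc 0)); rewrite -compDr !add0r. Qed.

Lemma compZl X Y Z (g : hom Y Z) (f : hom X Y) a : (a *: g) \oc f = a *: (g \oc f).
Proof. by have := comp_linl f a g 0; rewrite comp0l !addr0. Qed.

Lemma compZr X Y Z (g : hom Y Z) (f : hom X Y) a : g \oc (a *: f) = a *: (g \oc f).
Proof. by have := comp_linr g a f 0; rewrite comp0r !addr0. Qed.

Lemma comp_suml X Y Z (I : Type) (r : seq I) (g : I -> hom Y Z) (f : hom X Y) :
  (\sum_(i <- r) g i) \oc f = \sum_(i <- r) g i \oc f.
Proof.
by apply: (big_morph (fun g => g \oc f) (fun x y => compDl x y f) (comp0l _ f)).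
Qed.

Lemma comp_sumr X Y Z (I : Type) (r : seq I) (g : hom Y Z) (f : I -> hom X Y) :
  g \oc (\sum_(i <- r) f i) = \sum_(i <- r) g \oc f i.
Proof. by apply: (big_morph (fun f => g \oc f) (compDr g) (comp0r _ g)). Qed.

End LinCat.

Section FiniteDimension.
Variables (K : fieldType) (C : rigidCat K).
Hypothesis ssC : semisimple_cat C.
Local Notation oneC := (unit_ob (mon C)).

(** In R = End(1 + X), the ideal generated by the projector eps onto 1 contains an
    idempotent e = sum_k a_k eps b_k acting as the identity on it.  For v : 1 -> X,
    viewed in R, v = e v = sum_k a_k eps (b_k v), where the component of b_k v in
    End(1) is a scalar: the a_k restricted to 1 generate Hom(1, X). *)
Lemma hom_unit_fin_gen (X : C) : exists m (x : 'I_m -> hom oneC X), forall v,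
  exists c : 'I_m -> K, v = \sum_i c i *: x i.
Proof.
have [_ /(_ oneC X)[P [i1 [iX [p1 [pX [p1i1 pXiX pXi1 p1iX _]]]]]]] := ucat_additive C.
pose R := Endo P; pose eps : R := i1 \oc p1.
pose I : set R := fun x => exists s : seq (R * R), x = \sum_(p <- s) p.1 * eps * p.2.
have lI : left_ideal I.
  split; first by exists [::]; rewrite big_nil.
    by move=> _ _ [s1 ->] [s2 ->]; exists (s1 ++ s2); rewrite big_cat.
  move=> c _ [s ->]; exists [seq (c * p.1, p.2) | p <- s].
  by rewrite big_map mulr_sumr; apply: eq_bigr => p _; rewrite !mulrA.
have rI c x : I x -> I (x * c).
  move=> [s ->]; exists [seq (p.1, p.2 * c) | p <- s].
  by rewrite big_map mulr_suml; apply: eq_bigr => p _; rewrite !mulrA.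
have [e [[s sE] eI _]] := semisimple_two_sided (@ssC P) lI rI.
exists (size s), (fun k => pX \oc ((tnth (in_tuple s) k).1 : hom P P) \oc i1) => v.
pose w : R := iX \oc v \oc p1.
have ww : w * eps = w.
  by rewrite /w /eps -[LHS]/(_ \oc _) -Defs.compA (Defs.compA p1) p1i1 comp1c.
have Iw : I w by exists [:: (w, 1)]; rewrite big_seq1 mulr1 ww.
exists (fun k => end1 (p1 \oc ((tnth (in_tuple s) k).2 : hom P P) \oc w \oc i1)).
have vE : v = pX \oc (w : hom P P) \oc i1.
  by rewrite /w -!Defs.compA p1i1 compc1 Defs.compA pXiX comp1c.
have [ew _] := eI _ Iw; rewrite {1}vE -{1}ew sE mulr_suml.
rewrite [X in pX \oc X](_ : _ = \sum_(p <- s) ((p.1 * eps * p.2 * w : R) : hom P P)) //.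
rewrite comp_sumr comp_suml big_tnth; apply: eq_bigr => k _.
set p := tnth _ _; rewrite -[X in _ = _ *: X]compc1 -compZr end1K.
by rewrite -![_ * _ : Endo P]/(_ \oc _) /eps !Defs.compA.
Qed.


(** Duality: f |-> (f (x) 1) o coev embeds End(M) in Hom(1, M (x) M'), where M' is the dual
    of M, with the linear retraction psi given by the zigzag identity. *)
Lemma endo_fin_gen (M : C) : exists m (x : 'I_m -> Endo M), forall f,
  exists c : 'I_m -> K, f = \sum_i c i *: x i.
Proof.
pose mC := mon C; pose M' := dual M.
pose psi (g : hom oneC (tens mC M M')) : Endo M :=
  runit mC M \oc tensf mC (idc M) (ev M) \oc assoc mC M M' M \oc tensf mC g (idc M)
    \oc luniti mC M.
have psi_lin a g g' : psi (a *: g + g') = a *: psi g + psi g'.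
  by rewrite /psi tensf_linl compDr compZr compDl compZl.
(* naturality moves f to the left of the zigzag of M *)
have psi_comp (f : Endo M) : psi (tensf mC (f : hom M M) (idc M') \oc coev M) = f.
  set g : hom M M := f; set h := tensf mC g (idc M').
  have e1 : tensf mC (h \oc coev M) (idc M) =
      tensf mC h (idc M) \oc tensf mC (coev M) (idc M).
    by rewrite -tensf_comp comp1c.
  have e2 : assoc mC M M' M \oc tensf mC h (idc M) =
      tensf mC g (idc (tens mC M' M)) \oc assoc mC M M' M.
    by rewrite assoc_nat tensf1.
  have e3 : tensf mC (idc M) (ev M) \oc tensf mC g (idc (tens mC M' M)) =
      tensf mC g (idc _) \oc tensf mC (idc M) (ev M).
    by rewrite -!tensf_comp !comp1c !compc1.
  have e4 := runit_nat mC g.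
  rewrite -[RHS](compc1 g) -(dual_zigzag M) !Defs.compA -e4 -/mC.
  rewrite -[in RHS](Defs.compA (runit mC M)) -e3 /psi e1 -/mC !Defs.compA.
  congr (_ \oc _); rewrite -!Defs.compA; congr (_ \oc _).
  by congr (_ \oc _); rewrite !Defs.compA e2.
have [m [x xP]] := hom_unit_fin_gen (tens mC M M').
exists m, (fun i => psi (x i)) => f.
have [c cE] := xP (tensf mC (f : hom M M) (idc M') \oc coev M).
exists c; rewrite -[LHS]psi_comp cE.
have psi0 : psi 0 = 0.
  apply: (addIr (psi 0)); rewrite add0r -{1}[psi 0]scale1r -psi_lin.
  by rewrite scaler0 addr0.
have psiD g g' : psi (g + g') = psi g + psi g'.
  by have := psi_lin 1 g g'; rewrite !scale1r.
rewrite (big_morph psi psiD psi0); apply: eq_bigr => i _.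
by have := psi_lin (c i) (x i) 0; rewrite psi0 !addr0.
Qed.

(** A nonzero End(M), with linear coordinates r, becomes a finite-dimensional
    algebra. *)
Section EndoAlgebra.
Variables (M : C) (n : nat) (r : Endo M -> 'rV[K]_n).
Hypotheses (one_neq0 : (1 : Endo M) != 0) (r_lin : linear r) (r_bij : bijective r).

Definition endo_alg : Type := Endo M.
HB.instance Definition _ := GRing.PzRing.on endo_alg.
HB.instance Definition _ := GRing.Lmodule.on endo_alg.
HB.instance Definition _ := GRing.PzSemiRing_isNonZero.Build endo_alg one_neq0.

Let endo_scaleAl a (f g : endo_alg) : a *: (f * g) = (a *: f) * g.
Proof. by symmetry; exact: compZl. Qed.
HB.instance Definition _ := GRing.Lmodule_isLalgebra.Build K endo_alg endo_scaleAl.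

Let endo_scaleAr a (f g : endo_alg) : a *: (f * g) = f * (a *: g).
Proof. by symmetry; exact: compZr. Qed.
HB.instance Definition _ := GRing.Lalgebra_isAlgebra.Build K endo_alg endo_scaleAr.
HB.instance Definition _ :=
  Lmodule_hasFinDim.Build K endo_alg (exist2 _ _ r r_lin r_bij).
HB.instance Definition _ := Algebra_isFalgebra.Build K endo_alg.

Lemma nonzero_simple_factors_exist : exists D : simple_factors M, True.
Proof.
have [k [B [pr [Bs prZ prod]]]] := @simple_decomposition K endo_alg (@ssC M).
by exists (@SimpleFactors K C M 'I_k B Bs pr prZ prod).
Qed.

End EndoAlgebra.

(** When M is a zero object, End(M) is the empty product. *)
Lemma simple_factors_exist (M : C) : exists D : simple_factors M, True.
Proof.
have [one0|one_neq0] := eqVneq (1 : Endo M) 0.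
  have f0 (f : Endo M) : f = 0 by rewrite -[f]mulr1 one0 mulr0.
  pose B (v : void) : falgType K := match v with end.
  pose Bs v : simple_alg (B v) := match v with end.
  pose pr v : {rmorphism Endo M -> B v} := match v with end.
  have prZ v a f : pr v (a *: f) = a *: pr v f by case: v.
  have prod (y : forall v, B v) : exists! f, forall v, pr v f = y v.
    by exists 0; split=> [[]|f _].
  by exists (SimpleFactors Bs prZ prod).
have [m [x xP]] := endo_fin_gen M.
have [n [b bP]] := fin_gen_basis xP.
have hv f : exists c : {ffun 'I_n -> K}, f = \sum_i c i *: b i.
  by have [c [cE _]] := bP f; exists c.
have [v vE] := choice hv.
have bU (c : {ffun 'I_n -> K}) f : f = \sum_i c i *: b i -> v f = c.
  move=> fE; have [c' [_ cU]] := bP f.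
  by rewrite -(cU _ fE) -(cU _ (vE f)).
pose r (f : Endo M) : 'rV[K]_n := \row_i v f i.
have r_lin : linear r.
  move=> a f g; apply/rowP => i; rewrite !mxE.
  have -> : v (a *: f + g) = [ffun i => a * v f i + v g i].
    apply: bU; rewrite {1}(vE f) {1}(vE g) scaler_sumr -big_split.
    by apply: eq_bigr => j _; rewrite ffunE scalerDl scalerA.
  by rewrite ffunE.
have r_bij : bijective r.
  exists (fun u : 'rV_n => \sum_i u 0 i *: b i).
    by move=> f; rewrite [RHS]vE; apply: eq_bigr => i _; rewrite mxE.
  move=> u; apply/rowP => i; rewrite mxE (bU [ffun i => u 0 i]) ?ffunE //.
  by apply: eq_bigr => j _; rewrite ffunE.
exact: nonzero_simple_factors_exist one_neq0 r_lin r_bij.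
Qed.

End FiniteDimension.

(** * The zeta function *)

Section Exponential.
Variable K : fieldType.
Hypothesis charK : forall n, (n.+1%:R : K) != 0.
Variable u : nat -> K.
Hypothesis u0 : u 0%N = 0.

Let U N := trunc N u.

Let U_factor N : U N = (\poly_(i < N) u i.+1) * 'X.
Proof.
apply/polyP => -[|k]; rewrite coefMX /= coef_poly //.
by rewrite coef_poly ltnS.
Qed.

Let coef_U_exp N k j : (j < k)%N -> (U N ^+ k)`_j = 0.
Proof.
move=> ltjk; rewrite U_factor exprMn_comm; last exact: commr_polyX.
by rewrite coefMXn ltjk.
Qed.

(** One polynomial whose coefficients of index at most N are those of exp(u). *)
Definition exp_trunc N : {poly K} := \sum_(k < N.+1) (k`!%:R)^-1 *: U N ^+ k.

Lemma fps_exp_trunc N j : (j <= N)%N -> fps_exp u j = (exp_trunc N)`_j.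
Proof.
move=> lejN; rewrite /fps_exp /exp_trunc !coef_sum.
rewrite -(big_mkord xpredT (fun k => ((k`!%:R)^-1 *: U j ^+ k)`_j)).
rewrite -(big_mkord xpredT (fun k => ((k`!%:R)^-1 *: U N ^+ k)`_j)).
rewrite [RHS](big_cat_nat (n := j.+1)) //=.
rewrite [X in _ = _ + X]big_nat_cond [X in _ = _ + X]big1 ?addr0.
  apply: eq_bigr => k _; rewrite !coefZ; congr (_ * _).
  suff h : low_eq j (U j ^+ k) (U N ^+ k) by apply: h.
  elim: k => [|k IHk]; first by rewrite !expr0.
  rewrite !exprS; apply: low_eqM => // i lei.
  by rewrite !trunc_coef // (leq_trans lei).
by move=> k /andP[/andP[ltk _] _]; rewrite coefZ coef_U_exp ?mulr0.
Qed.

(** The derivative of sum_(k <= N) u^k / k! is u' times the same sum without its last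
    term, and t u^N vanishes modulo t^(N+1). *)
Lemma fps_exp_logder : logder (fun n => u n *+ n) (fps_exp u).
Proof.
move=> N; rewrite (fps_exp_trunc (leqnn N)) -coefXderiv.
have -> : 'X * (exp_trunc N)^`() =
    ('X * (U N)^`()) * exp_trunc N - (U N)^`() * (N`!%:R)^-1%:P * ('X * U N ^+ N).
  have -> : (exp_trunc N)^`() = (U N)^`() * (exp_trunc N - (N`!%:R)^-1 *: U N ^+ N).
    rewrite /exp_trunc [in RHS]big_ord_recr /= addrK.
    rewrite linear_sum big_ord_recl /= expr0 derivZ derivC scaler0 add0r mulr_sumr.
    apply: eq_bigr => i _; rewrite derivZ deriv_exp /bump /= add1n add0n -scaler_nat.
    by rewrite scalerA factS natrM invfM mulrAC mulVf // mul1r -scalerAr.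
  by rewrite mulrBr mulrBr -mul_polyC !mulrA [_ * 'X]mulrC !mulrA.
rewrite coefB [X in _ - X]coefM [X in _ - X]big1 ?subr0; last first.
  move=> k _; rewrite ['X * _]mulrC coefMX; case: ifP; rewrite ?mulr0 // => /negbT.
  rewrite -lt0n => lt; rewrite coef_U_exp ?mulr0 //.
  by rewrite (leq_trans _ (leq_subr k N)) // prednK.
rewrite coefM big_ord_recl coefXderiv mulr0n mul0r add0r; apply: eq_bigr => i _.
by rewrite coefXderiv /= /bump add1n trunc_coef // (fps_exp_trunc (leq_subr i.+1 N)).
Qed.

Lemma fps_exp0 : fps_exp u 0 = 1.
Proof. by rewrite /fps_exp big_ord1 expr0 fact0 invr1 scale1r coef1. Qed.

End Exponential.

Lemma mul_cancel_pairs (R : comPzRingType) (t y y' z z' : R) :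
  y * y' = 1 -> z * z' = 1 -> t = y' * z' * (y * z * t).
Proof.
move=> yy zz; have -> : y' * z' * (y * z * t) = t * (y * y') * (z * z').
  by rewrite !mulrA [LHS](ACl (5 * 3 * 1 * 4 * 2)).
by rewrite yy zz !mulr1.
Qed.

Section RatFun.
Variable K : fieldType.

Lemma fraction_repr (R : idomainType) (r : {fraction R}) :
  r * FracField.tofrac (\d_(repr r)) = FracField.tofrac (\n_(repr r)).
Proof.
rewrite -{1}[r]reprK; unlock FracField.tofrac.
rewrite -[LHS]FracField.pi_mul; apply/eqmodP; rewrite /= FracField.equivfE.
by rewrite /FracField.mulf !numden_Ratio ?mulr1 ?oner_eq0 ?denom_ratioP // mulrC.
Qed.

Lemma poly_tinv_neq0 (p : {poly K}) : p != 0 -> poly_tinv p != 0.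
Proof.
move=> p0; have := poly_tinv_rev (leqnSn (size p)) => h.
apply: contra p0 => /eqP p0; move: h; rewrite p0 mulr0 => /esym/eqP.
rewrite tofrac_eq0 => /eqP rev0; apply/eqP/polyP => k; rewrite coef0.
have [le|lt] := leqP (size p) k; first exact: nth_default.
have := congr1 (fun q : {poly K} => q`_(size p - k)) rev0.
by rewrite coef0 coef_poly ltnS leq_subr subKn // ltnW.
Qed.

Lemma ratfun_tinvE (p q : {poly K}) : q != 0 ->
  ratfun_tinv (p%:RF / q%:RF) = poly_tinv p / poly_tinv q.
Proof.
move=> q0; set r := p%:RF / q%:RF.
have d0 : \d_(repr r) != 0 by apply: denom_ratioP.
have e : p * \d_(repr r) = \n_(repr r) * q.
  apply/eqP; rewrite -tofrac_eq !tofracM -fraction_repr /r; apply/eqP.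
  by rewrite mulrAC divfK // tofrac_eq0.
rewrite /ratfun_tinv; apply/eqP; rewrite eqr_div ?poly_tinv_neq0 //.
by rewrite !poly_tinvE -!rmorphM /= e.
Qed.

(** If q z = p and q' z = p', then p q' = q q' z = p' q. *)
Lemma fps_eq_ratfun_unique (z : nat -> K) (r r' : {ratfun K}) :
  fps_eq_ratfun z r -> fps_eq_ratfun z r' -> r = r'.
Proof.
move=> [p [q [q0 -> hz]]] [p' [q' [q'0 -> hz']]].
have low N (a b : {poly K}) : (forall n, \sum_(i < n.+1) b`_i * z (n - i)%N = a`_n) ->
    low_eq N (b * trunc N z) a.
  move=> h k lek; rewrite -h coefM; apply: eq_bigr => i _.
  by rewrite trunc_coef // (leq_trans (leq_subr _ _)).
have e : p * q' = p' * q.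
  apply/polyP => N; apply: (@low_eq_trans _ N _ (q * q' * trunc N z)) => //.
    rewrite mulrAC; apply: low_eqM; first exact: low_eq_sym (low N _ _ hz).
    exact: low_eq_refl.
  rewrite [q * q']mulrC mulrAC; apply: low_eqM; first exact: low N _ _ hz'.
  exact: low_eq_refl.
by apply/eqP; rewrite eqr_div ?tofrac_eq0 // -!tofracM e.
Qed.

End RatFun.

Section Multiplicity.
Variables (K : fieldType) (C : rigidCat K).
Hypothesis charK : forall n, (n.+1%:R : K) != 0.
Variables (M : C) (D : simple_factors M).
Local Notation pr := (factor_pr D).

Lemma ctr_linear a (f g : Endo M) : ctr (a *: f + g) = a * ctr f + ctr g.
Proof.
rewrite /ctr tensf_linl comp_linr comp_linl.
set u := _ \oc _ \oc _; set v := _ \oc _ \oc _.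
by rewrite -[u]end1K -[v]end1K scalerA -scalerDl !end1_scale.
Qed.

Lemma ctrD (f g : Endo M) : ctr (f + g) = ctr f + ctr g.
Proof. by have := ctr_linear 1 f g; rewrite scale1r mul1r. Qed.

Lemma ctr0 : ctr (0 : Endo M) = 0.
Proof. by apply: (addIr (ctr (0 : Endo M))); rewrite -ctrD !add0r. Qed.

Lemma factor_inj (f g : Endo M) : (forall i, pr i f = pr i g) -> f = g.
Proof.
move=> fg; have [h [_ hU]] := factor_prod (fun i => pr i f).
by rewrite -(hU f) // -(hU g).
Qed.

(** The restriction of tr to each factor is represented by the nondegenerate form
    Trd. *)
Lemma mu_exists : exists u : Endo M, forall f, ctr f = TrdEnd D (u * f).
Proof.
have hiota i (a : factor D i) : exists f : Endo M,
    pr i f = a /\ forall j, i != j -> pr j f = 0.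
  have [f [fE _]] := factor_prod (dfwith (fun j => 0 : factor D j) a).
  exists f; split; first by rewrite fE dfwith_in.
  by move=> j ij; rewrite fE dfwith_out.
have [iota iotaP] := choice
  (fun p : {i : factor_idx D & factor D i} => hiota (projT1 p) (projT2 p)).
(* the inclusion of the factor A_i in End(M) *)
pose io i (a : factor D i) := iota (existT _ i a).
have io_in i (a : factor D i) : pr i (io i a) = a by have [] := iotaP (existT _ i a).
have io_out i (a : factor D i) j : i != j -> pr j (io i a) = 0.
  by have [_] := iotaP (existT _ i a); apply.
have io_lin i k (a b : factor D i) : io i (k *: a + b) = k *: io i a + io i b.
  apply: factor_inj => j; rewrite rmorphD factor_scale.
  have [<-|ij] := eqVneq i j; first by rewrite !io_in.
  by rewrite !io_out // scaler0 addr0.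
have fE f : f = \sum_i io i (pr i f).
  apply: factor_inj => j; rewrite rmorph_sum (bigD1 j) //= io_in big1 ?addr0 //.
  by move=> i ij; rewrite io_out.
have hu i : exists u, forall b, ctr (io i b) = Trd (u * b).
  apply: (Trd_represent charK (@factor_simple _ _ _ D i)) => k a b.
  by rewrite io_lin ctr_linear.
have [v [vE _]] := factor_prod (fun i => projT1 (cid (hu i))).
exists v => f; rewrite {1}(fE f) (big_morph _ ctrD ctr0); apply: eq_bigr => i _.
by rewrite rmorphM vE; case: (cid (hu i)) => u /= ->.
Qed.

Lemma muP f : ctr f = TrdEnd D (mu D * f).
Proof.
have [u uE] := mu_exists; rewrite /mu; case: xgetP => [v _ vP|/(_ u)/(_ uE)//].
exact: vP.
Qed.

Lemma ctr_multiplicity (m : factor_idx D -> int) : (forall i, mu_ i = (m i)%:~R) ->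
  forall f, ctr f = \sum_i (m i)%:~R * Trd (pr i f).
Proof.
move=> hm f; rewrite muP; apply: eq_bigr => i _.
have e (a : factor D i) : (m i)%:~R * a = ((m i)%:~R : K) *: a.
  by rewrite mulrzl scaler_int.
by rewrite rmorphM -/(mu_ i) hm e (Trd_scale charK (@factor_simple _ _ _ D i)).
Qed.

Variables (m : factor_idx D -> int).
Hypothesis hm : forall i, mu_ i = (m i)%:~R.

Lemma zeta_logder (f : Endo M) : logder (fun n => ctr (f ^+ n)) (zeta f).
Proof.
apply: eq_logder (fps_exp_logder charK _) => // n /=.
by rewrite -[LHS]mulr_natr mulfVK.
Qed.

Let Pf (f : Endo M) i : {poly K} := Nrd_poly (1 - (pr i f)%:P * 'X).

Lemma Nrd_poly_neq0 f i : Pf f i != 0.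
Proof.
apply/eqP => P0; have := Nrd_poly_coef0 charK (@factor_simple _ _ _ D i) (pr i f).
by rewrite -/(Pf f i) P0 coef0 => /eqP; rewrite eq_sym oner_eq0.
Qed.

(** The rational function with exponents - m i is written as a quotient of two
    polynomials by separating the signs of the m i. *)
Definition pos_part (k : int) : nat := if k is Posz n then n else 0.
Definition neg_part (k : int) : nat := if k is Negz n then n.+1 else 0.

Lemma int_parts (k : int) : k = (pos_part k)%:Z - (neg_part k)%:Z.
Proof. by case: k => n /=; rewrite ?subr0 // sub0r NegzE. Qed.

Lemma exp_parts (F : fieldType) (x : F) k : x != 0 ->
  x ^ (- k) = x ^+ neg_part k / x ^+ pos_part k.
Proof. by move=> x0; rewrite {1}(int_parts k) opprB expfzDr // exprnN. Qed.


Lemma prod_exp_parts (F : fieldType) (T : factor_idx D -> F) : (forall i, T i != 0) ->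
  \prod_i T i ^ (- m i) =
  (\prod_i T i ^+ neg_part (m i)) / \prod_i T i ^+ pos_part (m i).
Proof.
by move=> T0; rewrite -prodf_div; apply: eq_bigr => i _; apply: exp_parts.
Qed.

Let num f := \prod_i Pf f i ^+ neg_part (m i).
Let den f := \prod_i Pf f i ^+ pos_part (m i).

Let Pf_logder f i : logder (fun k => - Trd (pr i f ^+ k)) (nth 0 (Pf f i)).
Proof. exact: (Nrd_poly_logder charK (@factor_simple _ _ _ D i)). Qed.

Let prod_coef0 f (e : factor_idx D -> nat) : (\prod_i Pf f i ^+ e i)`_0 = 1.
Proof.
rewrite -horner_coef0 horner_prod big1 // => i _; rewrite horner_exp horner_coef0.
by rewrite (Nrd_poly_coef0 charK (@factor_simple _ _ _ D i)) expr1n.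
Qed.

Let den_neq0 f : den f != 0.
Proof.
apply/eqP => d0; have := prod_coef0 f (fun i => pos_part (m i)).
by rewrite -/(den f) d0 coef0 => /eqP; rewrite eq_sym oner_eq0.
Qed.

Let quotE f : \prod_i (Pf f i)%:RF ^ (- m i) = (num f)%:RF / (den f)%:RF.
Proof.
rewrite prod_exp_parts => [|i]; last by rewrite tofrac_eq0 Nrd_poly_neq0.
by rewrite !rmorph_prod; congr (_ / _); apply: eq_bigr => i _; rewrite rmorphXn.
Qed.

(** The numerator and the product of the denominator by Z(f,t) have the same
    logarithmic derivative and constant term 1. *)
Lemma zeta_product f :
  fps_eq_ratfun (zeta f) (\prod_i (Pf f i)%:RF ^ (- m i)).
Proof.
exists (num f), (den f); split=> // n; rewrite ?quotE //.
have hd := logder_poly_prod (fun i => logder_polyX (pos_part (m i)) (Pf_logder f i)).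
have hn := logder_poly_prod (fun i => logder_polyX (neg_part (m i)) (Pf_logder f i)).
have hz := logder_conv hd (zeta_logder f).
have inj k (x : K) : x *+ k.+1 = 0 -> x = 0.
  by rewrite -mulr_natr => /eqP; rewrite mulf_eq0 (negbTE (charK k)) orbF => /eqP.
apply: (logder_unique inj hz); last by rewrite conv0 !prod_coef0 mul1r /zeta fps_exp0.
apply: eq_logder hn => // k; rewrite (ctr_multiplicity hm) -big_split /=.
apply: eq_bigr => i _.
have -> : (m i)%:~R = (pos_part (m i))%:R - (neg_part (m i))%:R :> K.
  by case: (m i) => l /=; rewrite ?subr0 // sub0r NegzE rmorphN.
by rewrite mulrBl rmorphXn !mulNrn !mulr_natl addrA addNr sub0r.
Qed.

Let split i : splitting (factor D i) :=
  projT1 (cid (simple_splitting (@factor_simple _ _ _ D i))).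
Let deg i : nat := (sp_deg (split i) * \dim (centre (factor D i)))%N.

Definition chi_mult : int := \sum_i m i * (deg i)%:Z.

Lemma chi_multE : chi_mult%:~R = ctr (1 : Endo M).
Proof.
rewrite (ctr_multiplicity hm) rmorph_sum; apply: eq_bigr => i _ /=.
by rewrite rmorph1 (Trd1 charK (@factor_simple _ _ _ D i) (split i)) rmorphM.
Qed.

Lemma zeta_functional_equation (f g : Endo M) : f * g = 1 ->
  ratfun_tinv (\prod_i (Pf g i)%:RF ^ (- m i)) =
  (- ratfun_t K) ^ chi_mult * ratfun_const (det_end m f) *
    \prod_i (Pf f i)%:RF ^ (- m i).
Proof.
move=> fg.
have Tn0 i : poly_tinv (Pf g i) != 0 by rewrite poly_tinv_neq0 // Nrd_poly_neq0.
have -> : ratfun_tinv (\prod_i (Pf g i)%:RF ^ (- m i)) =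
    \prod_i poly_tinv (Pf g i) ^ (- m i).
  rewrite quotE ratfun_tinvE ?den_neq0 // (prod_exp_parts Tn0).
  rewrite !poly_tinvE !rmorph_prod.
  by congr (_ / _); apply: eq_bigr => i _; exact: rmorphXn.
have E i : (Pf f i)%:RF = (- ratfun_t K) ^ (deg i)%:Z *
    ratfun_const (Nrd (pr i f)) * poly_tinv (Pf g i).
  apply: (Nrd_poly_inverse charK (@factor_simple _ _ _ D i)).
  by rewrite -rmorphM fg rmorph1.
have x0 : - ratfun_t K != 0 by rewrite oppr_eq0 ratfun_t_neq0.
have Nn0 i : ratfun_const (Nrd (pr i f)) != 0.
  have Pn0 : (Pf f i)%:RF != 0 by rewrite tofrac_eq0 Nrd_poly_neq0.
  by apply: contraNneq Pn0 => N0; rewrite E N0 mulr0 mul0r.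
have -> : (- ratfun_t K) ^ chi_mult = \prod_i (- ratfun_t K) ^ (m i * (deg i)%:Z).
  rewrite /chi_mult; elim/big_rec2: _ => [|i y z _ <-]; first by rewrite expr0z.
  by rewrite expfzDr.
have -> : ratfun_const (det_end m f) = \prod_i ratfun_const (Nrd (pr i f)) ^ m i.
  rewrite -[LHS]/(ratfun_const_rmorph K _) rmorph_prod; apply: eq_bigr => i _.
  exact: fmorphXz.
rewrite -!big_split; apply: eq_bigr => i _ /=.
have cancel (y : {ratfun K}) (k : int) : y != 0 -> y ^ (- k) * y ^ k = 1.
  by move=> y0; rewrite -expfzDr // addNr expr0z.
have h1 := cancel _ (m i * (deg i)%:Z) x0; have h2 := cancel _ (m i) (Nn0 i).
rewrite E !expfzMl exprz_exp mulrN [_%:Z * m i]mulrC.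
move: h1 h2; move: (_ ^ m i) (_ ^ - m i) (_ ^ - (m i * _)) (_ ^ (m i * _)).
move: (_ ^ - m i) => t z' z y y' yy zz; exact: mul_cancel_pairs yy zz.

Qed.

End Multiplicity.

Theorem theorem3p2 (K : fieldType) (charK : [pchar K] =i pred0)
    (C : rigidCat K) (ssC : semisimple_cat C)
    (M : C) (intM : integral_type M) :
  (forall f : Endo M, exists r : {ratfun K}, fps_eq_ratfun (zeta f) r)
  /\
  forall D : simple_factors M,
    exists m : factor_idx D -> int,
    [/\ forall i, mu_ i = (m i)%:~R,
      forall f : Endo M,
        fps_eq_ratfun (zeta f)
          (\prod_i (Nrd_poly (1 - (factor_pr D i f)%:P * 'X))%:RF ^ (- m i))
      & exists2 chi : int, chi%:~R = ctr (1 : Endo M)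
        & forall f g : Endo M, f * g = 1 -> g * f = 1 ->
          forall rf rg : {ratfun K},
            fps_eq_ratfun (zeta f) rf -> fps_eq_ratfun (zeta g) rg ->
            ratfun_tinv rg
            = (- ratfun_t K) ^ chi * ratfun_const (det_end m f) * rf].
Proof.
have char0 n : (n.+1%:R : K) != 0 by have /pcharf0P-> := charK.
have mult (D : simple_factors M) : exists m : factor_idx D -> int,
    forall i, mu_ i = (m i)%:~R by have [m hm] := choice (intM D); exists m.
split.
  move=> f; have [D _] := simple_factors_exist ssC M; have [m hm] := mult D.
  by eexists; apply: (zeta_product char0 hm).
move=> D; have [m hm] := mult D; exists m; split=> // [f|].
  exact: zeta_product.
exists (chi_mult m); first exact: chi_multE.
move=> f g fg _ rf rg zf zg.
rewrite (fps_eq_ratfun_unique zf (zeta_product char0 hm f)).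
rewrite (fps_eq_ratfun_unique zg (zeta_product char0 hm g)).
exact: zeta_functional_equation.
Qed.
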